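(* Let $n\ge1$, let $\mathbf{i}=(i_1,\dots,i_n)$ be a sequence of non-negative integers with $S_{\mathrm{in}}:=\sum_{k}i_k=n-1$ and let $\mathbf{a}=(a_1,\dots,a_n)$ be a sequence of non-negative integers. One can couple (i.e. construct on a common probability space) the parking process on the uniform random tree $T(\mathbf{i})$ with car arrivals given by $\mathbf{a}$ and the (step-by-step construction of the) frozen configuration model $\mathrm{FCM}(\mathbf{i},\mathbf{a})$ with in-degree sequence $\mathbf{i}$ and out-degree sequence $\mathbf{a}$ in such a way that: (1) if the root of $T(\mathbf{i})$ contains a car at the end of the parking process, then the vertex set of its nearly parked component is the set of all blue vertices of $\mathrm{FCM}(\mathbf{i},\mathbf{a})$; all other nearly parked components of $T(\mathbf{i})$ are, as subsets of vertices, the white weakly connected components of $\mathrm{FCM}(\mathbf{i},\mathbf{a})$; (2) the out-legs deleted while constructing $\mathrm{FCM}(\mathbf{i},\mathbf{a})$ correspond to the cars that do not manage to park in $T(\mathbf{i})$; (3) conditionally on the forest of nearly parked components (including the information of whether the root has been revealed, i.e. contains a car, and in which component it is), the tree $T(\mathbf{i})$ is a uniform tree among the rooted plane labeled trees with numbers of children $\mathbf{i}$ that contain this forest.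
   Context: Trees: $T(\mathbf{i})$ is a uniformly random rooted plane tree with vertices labeled $1,\dots,n$ in which vertex $k$ has exactly $i_k$ children. Each vertex $k$ is regarded as carrying $i_k$ distinguishable in-legs (ordered by the plane structure), and each non-root vertex has one edge towards its parent, ending at one of the parent's in-legs. A forest carrying unmatched in-legs is contained in a tree if the tree is obtained from it by matching the parentless vertices other than the root of the whole tree to the unmatched in-legs. Parking process: $a_k$ cars arrive on vertex $k$; each vertex accommodates at most one car. Each car parks on its arrival vertex if it is free, and otherwise drives towards the root and parks on the first free vertex; if there is none, it exits the tree without parking. The final set of occupied vertices and the number of exiting cars do not depend on the order in which the cars are parked. Nearly parked components: the connected components of the subforest (on all $n$ vertices) formed by the edges going from an occupied vertex to its parent. Frozen configuration model $\mathrm{FCM}(\mathbf{i},\mathbf{o})$: start with $n$ white vertices labeled $1,\dots,n$, vertex $k$ having $i_k$ in-legs and $o_k$ out-legs, all distinguishable. Let $S_{\mathrm{out}}=\sum_k o_k$. At each step $m=1,\dots,S_{\mathrm{out}}$, choose $X_m$ uniformly at random among the out-legs not yet treated, independently of the past. If $X_m$ goes out from a blue vertex, delete it without matching it. If $X_m$ goes out from a white vertex, sample an unmatched in-leg $Y_m$ uniformly at random, independently of the past (if there is one), and match $X_m$ with $Y_m$ to create an oriented edge; if no unmatched in-leg remains, $X_m$ stays without partner and is removed from the graph. If the vertex incident to $Y_m$ was blue, or if the new edge creates a cycle (in the unoriented sense), or if there was no unmatched in-leg left, color blue all vertices of the weakly connected component of the vertex of $X_m$. The graph obtained after step $S_{\mathrm{out}}$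 is $\mathrm{FCM}(\mathbf{i},\mathbf{o})$. Weakly connected components are those of the underlying unoriented graph. A deleted out-leg is one that is deleted because it goes out from a blue vertex. Correspondence between out-legs and cars: the $a_k$ out-legs of vertex $k$ in $\mathrm{FCM}(\mathbf{i},\mathbf{a})$ are identified with the $a_k$ cars arriving on vertex $k$, and cars are parked one by one in the order $X_1,X_2,\dots,X_{S_{\mathrm{out}}}$ in which the out-legs are treated in the construction of $\mathrm{FCM}(\mathbf{i},\mathbf{a})$. *)

(* Defs.v *)
From HB Require Import structures.
From mathcomp Require Import all_boot all_order all_algebra.

Set Implicit Arguments.
Unset Strict Implicit.
Unset Printing Implicit Defensive.

Import Order.TTheory GRing.Theory Num.Theory.
Local Open Scope ring_scope.

(* Vertices are the elements of 'I_n.  For a degree sequence d, the type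
   [leg d] has exactly d k elements attached to each vertex k. *)
Definition leg (n : nat) (d : 'I_n -> nat) : finType := {k : 'I_n & 'I_(d k)}.

Definition leg_vertex (n : nat) (d : 'I_n -> nat) (x : leg d) : 'I_n := tag x.

(* Weak connectivity: components of the underlying unoriented graph of e. *)
Definition weak_component (n : nat) (e : rel 'I_n) (v : 'I_n) : {set 'I_n} :=
  [set w | connect [rel x y | e x y || e y x] v w].

Definition weak_components (n : nat) (e : rel 'I_n) : {set {set 'I_n}} :=
  [set weak_component e v | v : 'I_n].

Section Probability.
Variables (R : realFieldType) (Omega : finType).

Definition is_pmf (P : Omega -> R) : Prop :=
  (forall w, 0 <= P w) /\ \sum_w P w = 1.

Definition Pr (P : Omega -> R) (E : pred Omega) : R := \sum_(w | E w) P w.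

(* P(E | A), meaningful when 0 < Pr P A. *)
Definition cPr (P : Omega -> R) (E A : pred Omega) : R :=
  Pr P [pred w | E w && A w] / Pr P A.

(* The uniform mass function on the set A. *)
Definition unif (A : {set Omega}) (x : Omega) : R :=
  if x \in A then #|A|%:R^-1 else 0.

End Probability.

Section Trees.
Variables (n : nat) (i : 'I_n -> nat).

(* f v = Some l : the edge of v towards its parent ends at the in-leg l, hence
   the parent of v is leg_vertex l, and the rank of l in 'I_(i (leg_vertex l))
   is the rank of v among its siblings in the plane order.
   f v = None : v is parentless. *)
Definition plane_forest := {ffun 'I_n -> option (leg i)}.

Definition parent_edge (f : plane_forest) : rel 'I_n :=
  [rel u v | omap (@leg_vertex n i) (f u) == Some v].

Definition is_root (f : plane_forest) (r : 'I_n) : bool := f r == None.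

(* All vertices are descendants of one root, and every in-leg carries exactly
   one child, so that vertex k has exactly i k children. *)
Definition is_plane_tree (f : plane_forest) : bool :=
  [exists r, is_root f r && [forall v, connect (parent_edge f) v r]] &&
  [forall l, #|[set v | f v == Some l]| == 1%N].

Definition plane_tree : finType := {f : plane_forest | is_plane_tree f}.

End Trees.

Section Parking.
Variables (n : nat) (i a : 'I_n -> nat).

(* The first vertex outside occ met when driving from v towards the root.  The
   fuel bounds the number of edges driven; n is enough in a tree on n vertices. *)
Fixpoint first_free (fuel : nat) (t : plane_forest i) (occ : {set 'I_n})
    (v : 'I_n) : option 'I_n :=
  if v \notin occ then Some v
  else if fuel is fuel'.+1 then
    if t v is Some l then first_free fuel' t occ (leg_vertex l) else None
  else None.

Record parking_state := ParkingState {
  occupied : {set 'I_n};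
  exited : {set leg a}
}.

Definition park_car (t : plane_forest i) (s : parking_state) (c : leg a) :
    parking_state :=
  if first_free n t (occupied s) (leg_vertex c) is Some v
  then ParkingState (v |: occupied s) (exited s)
  else ParkingState (occupied s) (c |: exited s).

Definition park (t : plane_forest i) (cars : seq (leg a)) : parking_state :=
  foldl (park_car t) (ParkingState set0 set0) cars.

End Parking.

Section NearlyParked.
Variables (n : nat) (i : 'I_n -> nat).
Implicit Types (t : plane_forest i) (occ : {set 'I_n}).

(* The subforest, on all vertices, of the edges from occupied vertices. *)
Definition occupied_forest t occ : plane_forest i :=
  [ffun v => if v \in occ then t v else None].

Definition np_component t occ : 'I_n -> {set 'I_n} :=
  weak_component (parent_edge (occupied_forest t occ)).

Definition np_components t occ : {set {set 'I_n}} :=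
  weak_components (parent_edge (occupied_forest t occ)).

(* Some B if the root of t is occupied, B being its nearly parked component;
   None if the root is free. *)
Definition root_component t occ : option {set 'I_n} :=
  omap (np_component t occ) [pick r in occ | is_root t r].

(* The forest together with the information about the root. *)
Definition np_forest t occ : plane_forest i * option {set 'I_n} :=
  (occupied_forest t occ, root_component t occ).

(* The tree t is obtained from the forest by matching parentless vertices other
   than the root of t; if the root is revealed to lie in the component B, then
   the root of t has to be a vertex of B. *)
Definition contains_forest (phi : plane_forest i * option {set 'I_n}) t : bool :=
  [forall v, ~~ is_root phi.1 v ==> (t v == phi.1 v)] &&
  (if phi.2 is Some B then [exists r in B, is_root t r] else true).

End NearlyParked.

Section FrozenConfigurationModel.
Variables (n : nat) (i o : 'I_n -> nat).

(* [matching x = Some y] : the out-leg x is matched with the in-leg y.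
   [treated] contains the matched out-legs, the deleted ones, and those that
   were removed because no unmatched in-leg was left; [deleted] contains only
   the out-legs deleted because they go out from a blue vertex. *)
Record fcm_state := FcmState {
  matching : {ffun leg o -> option (leg i)};
  treated : {set leg o};
  deleted : {set leg o};
  blue : {set 'I_n}
}.

Definition fcm_init : fcm_state := FcmState [ffun=> None] set0 set0 set0.

Definition fcm_edge (g : {ffun leg o -> option (leg i)}) : rel 'I_n :=
  [rel u v | [exists x, (leg_vertex x == u) &&
                        (omap (@leg_vertex n i) (g x) == Some v)]].

Definition untreated (s : fcm_state) : {set leg o} := ~: treated s.

Definition unmatched_in (s : fcm_state) : {set leg i} :=
  [set y | [forall x, matching s x != Some y]].

(* A step is a pair (X_m, Y_m), with Y_m = None when no in-leg is sampled.
   The new edge X_m -> Y_m closes an unoriented cycle (possibly a loop or a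
   double edge) iff its ends are already weakly connected before it is added. *)
Definition fcm_step (s : fcm_state) (xy : leg o * option (leg i)) : fcm_state :=
  let: (x, y) := xy in
  if leg_vertex x \in blue s then
    FcmState (matching s) (x |: treated s) (x |: deleted s) (blue s)
  else
    let g := [ffun z => if z == x then y else matching s z] in
    let freeze :=
      if y is Some l then
        (leg_vertex l \in blue s) ||
        (leg_vertex l \in weak_component (fcm_edge (matching s)) (leg_vertex x))
      else true in
    FcmState g (x |: treated s) (deleted s)
      (if freeze then blue s :|: weak_component (fcm_edge g) (leg_vertex x)
       else blue s).

Definition fcm_run (tr : seq (leg o * option (leg i))) : fcm_state :=
  foldl fcm_step fcm_init tr.

(* Probability of the step (X_m, Y_m) given that the past has led to s. *)
Definition fcm_step_prob (R : realFieldType) (s : fcm_state)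
    (xy : leg o * option (leg i)) : R :=
  let: (x, y) := xy in
  unif R (untreated s) x *
  (if (leg_vertex x \in blue s) || (unmatched_in s == set0) then
     if y is None then 1 else 0
   else
     if y is Some l then unif R (unmatched_in s) l else 0).

(* Probability that the construction, started from s, performs the steps tr. *)
Fixpoint fcm_prob_from (R : realFieldType) (s : fcm_state)
    (tr : seq (leg o * option (leg i))) : R :=
  if tr is xy :: tr' then
    fcm_step_prob R s xy * fcm_prob_from R (fcm_step s xy) tr'
  else 1.

Definition fcm_prob (R : realFieldType) : seq (leg o * option (leg i)) -> R :=
  fcm_prob_from R fcm_init.

Definition white_components (s : fcm_state) : {set {set 'I_n}} :=
  [set C in weak_components (fcm_edge (matching s)) | C \subset ~: blue s].

End FrozenConfigurationModel.

(* Main.v *)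
Require Import Defs.
From HB Require Import structures.
From mathcomp Require Import all_boot all_order all_algebra.
From mathcomp Require Import zify.

Set Implicit Arguments.
Unset Strict Implicit.
Unset Printing Implicit Defensive.

Import Order.TTheory GRing.Theory Num.Theory.
Local Open Scope ring_scope.

(** The same out-legs, that is, the same cars, are treated in both
    constructions, in an order that is independent of the tree, and the
    partners of the out-legs are chosen along the tree. When a car arrives
    in a component whose root r is free, it parks on r, and this reveals the
    edge of the tree that leaves r. If this edge ends at an in-leg of
    another white component, the out-leg is matched with this in-leg, and
    the same two components merge on both sides. Otherwise r is the root of
    the tree or is attached to the blue component, that of the root, and the
    partner is drawn uniformly among the legs that color the component of r
    blue: the unmatched legs of blue vertices and those of the component
    itself (there is no partner if no unmatched leg is left, which also
    colors the component blue). So the white components are at each time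
    those with a free root, the blue vertices form the component of the root
    of the tree when it is occupied, and a car cannot park exactly when it
    arrives on a blue vertex. This is the invariant [coupled], preserved by
    [coupled_step].

    It remains to see that the partner is uniform among the unmatched
    in-legs when the tree is averaged out. A forest with k components
    extends to (k - 1)! trees, however its k - 1 free in-legs are
    distributed ([card_extensions]); hence (k - 2)! times the number of free
    in-legs of a component is the number of these trees that are rooted in
    it ([card_extensions_at]). It follows that r is attached to each leg of
    another white component with the same probability 1 / u, where u is the
    number of in-legs that are unmatched in the configuration model
    ([card_agreeing_attach]), so that the remaining event has the right
    probability, that of drawing one of the legs that freeze the component
    ([card_unsettled], [sum_unif_admissible]). Since the tree stays uniform
    among those that agree with what parking has revealed, the steps have
    the law of the configuration model ([sum_coupled_prob_fibre]).

    Finally, since the order of the out-legs is independent of the tree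
    ([sum_coupled_prob_order]) and since for a given order parking cannot
    distinguish two trees containing the same final forest
    ([final_forest_eq]), all trees containing this forest are equally likely
    given it. *)

(** * Weak components *)

Section WeakComponents.
Variable n : nat.
Implicit Types (e : rel 'I_n) (u v w : 'I_n).

Lemma mem_weak_component e v : v \in weak_component e v.
Proof. by rewrite inE connect0. Qed.

Lemma weak_component_sym e v w :
  (w \in weak_component e v) = (v \in weak_component e w).
Proof.
rewrite !inE (@sym_connect_sym _ [rel x y | e x y || e y x]) // => x y /=.
by rewrite orbC.
Qed.

Lemma weak_component_trans e u v w :
  v \in weak_component e u -> w \in weak_component e v ->
  w \in weak_component e u.
Proof. by rewrite !inE; apply: connect_trans. Qed.

Lemma weak_component_edge e v w : e v w -> w \in weak_component e v.
Proof. by move=> evw; rewrite inE connect1 //= evw. Qed.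

Lemma eq_weak_component e v w :
  w \in weak_component e v -> weak_component e w = weak_component e v.
Proof.
move=> vw; apply/setP=> z; apply/idP/idP; first exact: weak_component_trans.
by apply: weak_component_trans; rewrite weak_component_sym.
Qed.

Lemma weak_component_ind e (A : eqType) (h : 'I_n -> A) v w :
  (forall x y, e x y -> h x = h y) -> w \in weak_component e v -> h v = h w.
Proof.
move=> he; rewrite inE => /connectP[p + ->].
elim: p v => //= x p IHp v /andP[/orP[] /he hvx /IHp <-] //.
Qed.

(** A path of [e'] can be shortened so as to use the new edge at most once, in
    one of its two directions; the two last cases are these directions. *)
Lemma weak_component_add e e' a b v w :
  (forall x y, e' x y = e x y || (x == a) && (y == b)) ->
  (w \in weak_component e' v) =
    [|| w \in weak_component e v,
        (a \in weak_component e v) && (w \in weak_component e b) |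
        (b \in weak_component e v) && (w \in weak_component e a)].
Proof.
move=> e'E.
have sub x y : y \in weak_component e x -> y \in weak_component e' x.
  rewrite !inE; apply: connect_sub => {}x {}y /= exy; apply: connect1 => /=.
  by rewrite !e'E; case/orP: exy => ->; rewrite ?orbT.
have ab : b \in weak_component e' a.
  by apply: weak_component_edge; rewrite e'E !eqxx orbT.
apply/idP/idP; last first.
  case/or3P => [/sub // | /andP[/sub va /sub bw] | /andP[/sub vb /sub aw]].
    by apply: weak_component_trans bw; apply: weak_component_trans ab.
  apply: weak_component_trans aw; apply: weak_component_trans vb _.
  by rewrite weak_component_sym.
rewrite {1}inE => /connectP[p + ->] {w}.
elim: p v => [|x p IHp] v /=; first by rewrite mem_weak_component.
case/andP=> vx /IHp {IHp}; move: (last x p) => w.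
have [evx | nevx] := boolP (e v x || e x v).
  have Ex : weak_component e x = weak_component e v.
    by apply: eq_weak_component; rewrite inE connect1.
  by rewrite Ex.
have : [&& v == a & x == b] || [&& x == a & v == b].
  by move: vx nevx; rewrite !e'E negb_or; case: (e v x); case: (e x v).
case/orP=> /andP[/eqP-> /eqP->]; rewrite !mem_weak_component /=.
  by case/or3P=> [->|/andP[_ ->]|->]; rewrite ?orbT.
by case/or3P=> [->|->|/andP[_ ->]]; rewrite ?orbT.
Qed.

End WeakComponents.

(** * Rooted forests *)


Section Forests.
Variables (n : nat) (i : 'I_n -> nat).
Implicit Types (f t : plane_forest i) (l : leg i) (u v w r : 'I_n).

Definition parent f v := if f v is Some l then leg_vertex l else v.

(** In an acyclic forest this is the root of the component of [v]: n steps are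
    enough to get there, and [parent] fixes the roots. *)
Definition top f v := iter n (parent f) v.

Definition acyclic f := [forall v, is_root f (top f v)].

Definition leg_inj f := forall v w l, f v = Some l -> f w = Some l -> v = w.

Definition forest_roots f := [set v | is_root f v].

Definition free_legs f := [set l | [forall v, f v != Some l]].

Definition subforest f t := [forall v, ~~ is_root f v ==> (t v == f v)].

Lemma parent_root f r : is_root f r -> parent f r = r.
Proof. by rewrite /is_root /parent => /eqP->. Qed.

Lemma iter_parent_root f r m : is_root f r -> iter m (parent f) r = r.
Proof. by move=> rr; elim: m => //= m ->; rewrite parent_root. Qed.

Lemma top_root f r : is_root f r -> top f r = r.
Proof. exact: iter_parent_root. Qed.

(** A path that reaches a root is shorter than the number of vertices: this is
    what the number of iterations in [top] is for. *)
Lemma top_reach f m v r : is_root f r -> iter m (parent f) v = r -> top f v = r.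
Proof.
move=> rr vr; have c : fconnect (parent f) v r by rewrite -vr fconnect_iter.
have [k nE] : exists k, n = (k + findex (parent f) v r)%N.
  exists (n - findex (parent f) v r)%N; rewrite subnK //.
  apply: ltnW; apply: leq_trans (findex_max c) _.
  by rewrite /order -[X in (_ <= X)%N](card_ord n) max_card.
(* The type of the vertices depends on n, which cannot be rewritten as such. *)
suff gen m' : m' = (k + findex (parent f) v r)%N -> iter m' (parent f) v = r.
  exact: gen.
by move=> ->; rewrite iterD iter_findex // iter_parent_root.
Qed.

Lemma is_root_top f v : acyclic f -> is_root f (top f v).
Proof. by move/forallP. Qed.

Lemma top_parent f v : acyclic f -> top f (parent f v) = top f v.
Proof. by move=> af; rewrite /top -iterSr iterS parent_root // is_root_top. Qed.

Lemma top_some f v l : acyclic f -> f v = Some l -> top f (leg_vertex l) = top f v.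
Proof. by move=> af fv; rewrite -[RHS]top_parent // /parent fv. Qed.

Lemma acyclicP f :
  (forall v, exists m, is_root f (iter m (parent f) v)) -> acyclic f.
Proof.
move=> H; apply/forallP=> v; have [m rr] := H v.
by rewrite (top_reach rr (erefl _)).
Qed.

Lemma connect_parent_top f v : connect (parent_edge f) v (top f v).
Proof.
suff gen m : connect (parent_edge f) v (iter m (parent f) v) by exact: gen.
elim: m => [|m IHm]; first exact: connect0.
apply: connect_trans IHm _; rewrite iterS /parent.
move: (iter m _ _) => y; case fy: (f y) => [l|]; last exact: connect0.
by apply: connect1; rewrite /parent_edge /= fy.
Qed.

Lemma weak_component_forest f v : acyclic f ->
  weak_component (parent_edge f) v = [set w | top f w == top f v].
Proof.
move=> af; apply/setP=> w; rewrite [RHS]inE.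
have toTop x : top f x \in weak_component (parent_edge f) x.
  rewrite inE; apply: connect_sub (connect_parent_top f x) => y z e.
  by apply: connect1; rewrite /= e.
apply/idP/eqP => [vw | E].
  apply/esym; apply: weak_component_ind vw => x y; rewrite /parent_edge /=.
  by case fx: (f x) => [l|] //= /eqP[<-]; rewrite (top_some af fx).
by apply: weak_component_trans (toTop v) _; rewrite -E weak_component_sym.
Qed.

Lemma subforest_some f t v l : subforest f t -> f v = Some l -> t v = Some l.
Proof. by move/forallP/(_ v); rewrite /is_root => + fv; rewrite fv => /eqP. Qed.

Lemma subforest_root f t r : subforest f t -> is_root t r -> is_root f r.
Proof.
move=> ft; rewrite /is_root; case fr: (f r) => [l|] //.
by rewrite (subforest_some ft fr).
Qed.

Lemma subforest_acyclic f t : subforest f t -> acyclic t -> acyclic f.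
Proof.
move=> ft ta; apply/forallP=> v.
(* The two paths from v agree until that of f stops. *)
have: is_root f (top f v) \/ top f v = top t v.
  suff gen m : is_root f (iter m (parent f) v) \/
               iter m (parent f) v = iter m (parent t) v by exact: gen.
  elim: m => [|m IHm]; first by right.
  rewrite !iterS; case: IHm => [rr | ->]; first by left; rewrite parent_root.
  move: (iter m _ _) => y; case fy: (f y) => [l|].
    by right; rewrite /parent fy (subforest_some ft fy).
  by left; rewrite /parent fy /is_root fy.
by case=> // ->; apply: subforest_root ft _; apply: is_root_top.
Qed.

(** A path of [t] can enter a component of [f] only by a new edge, which ends at
    an in-leg of this component that is free in [f]. *)
Lemma subforest_closed f t r v : acyclic f -> subforest f t -> leg_inj t ->
    (forall l, l \in free_legs f -> top f (leg_vertex l) != r) ->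
  top f (top t v) = r -> top f v = r.
Proof.
move=> fa ft ti nofree.
suff gen m : top f (iter m (parent t) v) = r -> top f v = r by exact: gen.
elim: m v => //= m IHm v.
rewrite -iterS iterSr => /IHm {IHm}; rewrite {1}/parent.
case tv: (t v) => [l|] // lr; case fv: (f v) => [l'|].
  move: (subforest_some ft fv) lr; rewrite tv -(top_some fa fv) => -[->].
  by [].
have /nofree : l \in free_legs f; last by rewrite lr eqxx.
rewrite inE; apply/forallP=> w; apply/eqP=> fw.
by move: fv; rewrite -(ti _ _ _ (subforest_some ft fw) tv) fw.
Qed.

(** Otherwise the new edge would close a cycle: the component of [r] in [f]
    would be stable under [parent t], although [t] has no root there. *)
Lemma subforest_parent_top f t r l : acyclic t -> subforest f t ->
  is_root f r -> t r = Some l -> top f (leg_vertex l) != r.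
Proof.
move=> ta ft rr tr; have fa := subforest_acyclic ft ta; apply/eqP=> lr.
have: top f (top t r) = r.
  suff gen m : top f (iter m (parent t) r) = r by exact: gen.
  elim: m => [|m IHm] /=; first exact: top_root.
  move: (iter m _ _) IHm => y yr; rewrite /parent; case ty: (t y) => [l'|] //.
  case fy: (f y) => [l''|].
    by have := subforest_some ft fy; rewrite ty => -[->]; rewrite (top_some fa fy).
  have ry: r = y by rewrite -yr top_root // /is_root fy.
  by move: ty; rewrite -ry tr => -[<-].
have tt := is_root_top r ta.
rewrite top_root ?(subforest_root ft) // => E.
by move: tt; rewrite E /is_root tr.
Qed.

Definition attach f r l : plane_forest i :=
  [ffun v => if v == r then Some l else f v].

Section Attach.
Variables (f : plane_forest i) (r : 'I_n) (l : leg i).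
Hypotheses (fa : acyclic f) (rr : is_root f r).
Hypothesis lr : top f (leg_vertex l) != r.

Let f' := attach f r l.

Lemma parent_attach v : v != r -> parent f' v = parent f v.
Proof. by move=> /negbTE vr; rewrite /parent ffunE vr. Qed.

Lemma attach_root v : is_root f' v = (v != r) && is_root f v.
Proof. by rewrite /is_root ffunE; case: (v == r). Qed.

Lemma iter_attach m v : top f v != r ->
  iter m (parent f') v = iter m (parent f) v.
Proof.
elim: m => //= m IHm vr; rewrite IHm // parent_attach //.
apply: contraNneq vr => E; apply/eqP; exact: top_reach E.
Qed.

Lemma iter_attach_root v : top f v = r -> exists m, iter m (parent f') v = r.
Proof.
suff gen m : iter m (parent f) v = r -> exists m', iter m' (parent f') v = r.
  exact: gen.
elim: m v => [|m IHm] v; first by exists 0%N.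
have [-> _ | vr] := eqVneq v r; first by exists 0%N.
rewrite iterSr => /IHm[k kr]; exists k.+1; by rewrite iterSr parent_attach.
Qed.

Lemma reach_attach v :
  exists m, iter m (parent f') v =
    if top f v == r then top f (leg_vertex l) else top f v.
Proof.
case: eqP => [/iter_attach_root[m mr] | /eqP vr].
  exists (n + m.+1)%N; rewrite iterD iterS mr /parent ffunE eqxx.
  exact: iter_attach.
by exists n; apply: iter_attach.
Qed.

Lemma attach_root_top v :
  is_root f' (if top f v == r then top f (leg_vertex l) else top f v).
Proof.
rewrite attach_root; case: (eqVneq (top f v) r) => vr;
  by rewrite ?lr ?vr is_root_top.
Qed.

Lemma acyclic_attach : acyclic f'.
Proof.
apply: acyclicP => v; have [m mE] := reach_attach v.
by exists m; rewrite mE attach_root_top.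
Qed.

Lemma top_attach v :
  top f' v = if top f v == r then top f (leg_vertex l) else top f v.
Proof. by have [m] := reach_attach v; apply: top_reach; apply: attach_root_top. Qed.

End Attach.

Lemma leg_inj_attach f r l :
  leg_inj f -> l \in free_legs f -> leg_inj (attach f r l).
Proof.
rewrite inE => fi /forallP lf v w l'; rewrite !ffunE.
case: eqP => [-> [<-]|_ fv].
  by case: eqP => [-> //|_ /eqP]; rewrite (negbTE (lf w)).
by case: eqP => [-> [E]|_ /(fi _ _ _ fv)] //; move: (lf v); rewrite fv E eqxx.
Qed.

Lemma roots_attach f r l : forest_roots (attach f r l) = forest_roots f :\ r.
Proof. by apply/setP=> v; rewrite !inE attach_root. Qed.

Lemma free_legs_attach f r l : is_root f r ->
  free_legs (attach f r l) = free_legs f :\ l.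
Proof.
move=> /eqP fr; apply/setP=> l'; rewrite !inE; apply/forallP/andP.
  move=> H; split; last first.
    apply/forallP=> v; have := H v; rewrite ffunE.
    by case: (v =P r) => [-> _|//]; rewrite fr.
  by have := H r; rewrite ffunE eqxx; apply: contraNneq => ->.
move=> [ll' /forallP H] v; rewrite ffunE; case: (v =P r) => // _.
by apply: contraNneq ll' => -[->].
Qed.

Lemma subforest_attach f t r l : is_root f r ->
  subforest (attach f r l) t = subforest f t && (t r == Some l).
Proof.
move=> /eqP fr; apply/forallP/andP => [H | [/forallP H /eqP tr] v].
  split; last by have := H r; rewrite attach_root eqxx ffunE eqxx.
  apply/forallP=> v; have := H v; rewrite attach_root ffunE.
  by case: (v =P r) => // ->; rewrite /is_root fr.
rewrite attach_root ffunE; case: (v =P r) => [-> |_ /=]; last exact: H.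
by rewrite tr eqxx implybT.
Qed.

End Forests.

(** * Counting the trees that extend a forest *)

Section PlaneTrees.
Variables (n : nat) (i : 'I_n -> nat).
Implicit Types (f : plane_forest i) (t : plane_tree i) (l : leg i).
Implicit Types (u v w r : 'I_n).

Lemma tree_acyclic t : acyclic (val t).
Proof.
case/andP: (valP t) => /existsP[r /andP[rr /forallP cr]] _.
apply: acyclicP => v; case/connectP: (cr v) => p; elim: p v => [|x p IHp] v /=.
  by move=> _ <-; exists 0%N.
case/andP => e /IHp H /H[m mr]; exists m.+1; rewrite iterSr.
by move: e; rewrite /parent_edge /= /parent; case: (val t v) => //= l /eqP[->].
Qed.

Lemma tree_leg_inj t : leg_inj (val t).
Proof.
case/andP: (valP t) => _ /forallP H v w l vl wl.
case/cards1P: (H l) => x E.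
have: v \in [set x] by rewrite -E inE vl.
have: w \in [set x] by rewrite -E inE wl.
by rewrite !inE => /eqP-> /eqP->.
Qed.

Lemma tree_root_unique t v w : is_root (val t) v -> is_root (val t) w -> v = w.
Proof.
case/andP: (valP t) => /existsP[r /andP[rr /forallP cr]] _.
have H x : is_root (val t) x -> x = r.
  case/connectP: (cr x) => [[|y p]] //= /andP[e _] _.
  by move: e; rewrite /is_root /parent_edge /=; case: (val t x).
by move=> /H-> /H->.
Qed.

Lemma card_leg : #|leg i| = (\sum_k i k)%N.
Proof.
rewrite card_tagged sumnE big_map big_enum /=.
by apply: eq_bigr => k _; rewrite card_ord.
Qed.

Lemma card_free_legs f : leg_inj f ->
  (#|free_legs f| + n = \sum_k i k + #|forest_roots f|)%N.
Proof.
move=> fi.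
have E : [set Some l | l in ~: free_legs f] = [set f v | v in ~: forest_roots f].
  apply/setP=> z; apply/imsetP/imsetP => [[l] | [v]].
    rewrite !inE negb_forall => /existsP[v]; rewrite negbK => /eqP fv ->.
    by exists v; rewrite ?fv // !inE /is_root fv.
  rewrite !inE /is_root; case fv: (f v) => [l|] // _ ->; exists l => //.
  by rewrite !inE negb_forall; apply/existsP; exists v; rewrite fv eqxx.
have: #|~: free_legs f| = #|~: forest_roots f|.
  rewrite -(card_imset _ (@Some_inj _)) E card_in_imset // => v w.
  rewrite !inE /is_root; case fv: (f v) => [l|] // _ _.
  by move=> /esym fw; apply: fi fv fw.
have := cardsC (free_legs f); have := cardsC (forest_roots f).
rewrite card_leg card_ord; lia.
Qed.

Hypotheses (n_gt0 : (0 < n)%N) (sum_in : (\sum_k i k = n - 1)%N).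

Lemma forest_is_plane_tree f :
  acyclic f -> leg_inj f -> #|forest_roots f| = 1%N -> is_plane_tree f.
Proof.
move=> fa fi f1; have /cards1P[r rE] : #|forest_roots f| == 1%N by rewrite f1.
have rootE v : is_root f v = (v == r) by have /setP/(_ v) := rE; rewrite !inE.
apply/andP; split.
  apply/existsP; exists r; rewrite rootE eqxx /=; apply/forallP=> v.
  have := connect_parent_top f v; have := is_root_top v fa.
  by rewrite rootE => /eqP->.
apply/forallP=> l; have: #|free_legs f| = 0%N.
  by have := card_free_legs fi; rewrite f1 sum_in; lia.
move/eqP; rewrite cards_eq0 => /eqP/setP/(_ l); rewrite !inE => /negbT.
rewrite negb_forall => /existsP[v]; rewrite negbK => /eqP fv.
apply/cards1P; exists v; apply/setP=> w; rewrite !inE.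
by apply/eqP/eqP => [fw | ->] //; apply: fi fw fv.
Qed.

Definition extensions f := [set t : plane_tree i | subforest f (val t)].

Definition extensions_at f r := [set t in extensions f | is_root (val t) r].

Lemma extensions_attach f r l : is_root f r ->
  extensions (attach f r l) = [set t in extensions f | val t r == Some l].
Proof. by move=> rr; apply/setP=> t; rewrite !inE subforest_attach. Qed.

Lemma extensions_attach0 f r l : is_root f r ->
  ~~ ((l \in free_legs f) && (top f (leg_vertex l) != r)) ->
  extensions (attach f r l) = set0.
Proof.
move=> rr H; apply/setP=> t; rewrite extensions_attach // !inE.
apply: contraNF H => /andP[ft /eqP tr].
rewrite (subforest_parent_top (tree_acyclic t) ft rr tr) andbT inE.
apply/forallP=> v; apply/eqP => fv.
move: (subforest_some ft fv) => tv; move: rr.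
by rewrite -(tree_leg_inj tv tr) /is_root fv.
Qed.

Lemma card_extensions_split f r : is_root f r ->
  #|extensions f| = (#|extensions_at f r| +
    \sum_(l in free_legs f | top f (leg_vertex l) != r)
      #|extensions (attach f r l)|)%N.
Proof.
move=> rr; rewrite -sum1_card (partition_big (fun t => val t r) xpredT) //=.
rewrite (bigD1 None) //= sum1_card; congr (_ + _)%N.
  by apply: eq_card => t; rewrite inE.
rewrite (reindex_omap Some id) => [|[l|]] //=.
rewrite [RHS]big_mkcond /=; apply: eq_big => [l | l _]; first by rewrite eqxx.
rewrite sum1_card; case: ifPn => [_ | /(extensions_attach0 rr) E].
  by rewrite extensions_attach //; apply: eq_card => t; rewrite inE.
rewrite extensions_attach // in E.
by rewrite -(cards0 (plane_tree i)) -E; apply: eq_card => t; rewrite [RHS]inE.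
Qed.

(** The count does not depend on how the free legs are distributed: a forest
    with k + 2 components has k + 1 free legs, so that some component has none.
    Its root is not the root of an extension, and hence is attached to one of
    the k + 1 free legs, all of which lie in other components; this leaves a
    forest with k + 1 components. *)
Theorem card_extensions k f : acyclic f -> leg_inj f -> #|forest_roots f| = k.+1 ->
  #|extensions f| = k`!.
Proof.
elim: k f => [|k IHk] f fa fi fk.
  have ft := forest_is_plane_tree fa fi fk.
  apply/eqP/cards1P; exists (Sub f ft); apply/setP=> t; rewrite !inE -val_eqE /=.
  apply/idP/eqP => [st | ->]; last by apply/forallP=> v; rewrite eqxx implybT.
  apply/ffunP=> v; case fv: (f v) => [l|]; first exact: subforest_some st fv.
  have rt := is_root_top v (tree_acyclic t).
  have /cards1P[r rE] : #|forest_roots f| == 1%N by rewrite fk.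
  have rootE w : is_root f w -> w = r.
    by have /setP/(_ w) := rE; rewrite !inE => -> /eqP.
  move: (rt); rewrite (rootE _ (subforest_root st rt)) -(rootE v) /is_root ?fv //.
  by move/eqP.
have nfree : #|free_legs f| = k.+1.
  by have := card_free_legs fi; rewrite fk sum_in; lia.
have [r rr leaf] : exists2 r, is_root f r &
    forall l, l \in free_legs f -> top f (leg_vertex l) != r.
  pose A := [set top f (leg_vertex l) | l in free_legs f].
  have: ~~ (forest_roots f \subset A).
    apply/negP=> /subset_leq_card; rewrite fk ltnNge.
    by move/negP; apply; rewrite -nfree leq_imset_card.
  case/subsetPn => r; rewrite inE => rr rA; exists r => // l lf.
  by apply: contraNneq rA => <-; apply: imset_f.
rewrite (card_extensions_split rr).
have -> : extensions_at f r = set0.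
  apply/setP=> t; rewrite !inE; apply/negP=> /andP[st tr].
  have [r' rr' r'r] : exists2 r', is_root f r' & r' != r.
    have: (0 < #|forest_roots f :\ r|)%N.
      by have := cardsD1 r (forest_roots f); rewrite inE rr fk; lia.
    by case/card_gt0P=> r'; rewrite !inE => /andP[r'r rr']; exists r'.
  have tt := is_root_top r' (tree_acyclic t).
  have := @subforest_closed _ _ f (val t) r r' fa st (@tree_leg_inj t) leaf.
  rewrite (tree_root_unique tt tr) !top_root // => /(_ erefl) E.
  by rewrite E eqxx in r'r.
rewrite cards0 add0n (eq_bigr (fun=> k`!)).
  rewrite sum_nat_const factS -nfree; congr (_ * _)%N.
  apply: eq_card => l; rewrite [LHS]inE /=.
  by case lf: (l \in _) => //=; apply: leaf.
move=> l /andP[lf lr]; apply: IHk; first exact: acyclic_attach.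
  exact: leg_inj_attach.
by rewrite roots_attach; have := cardsD1 r (forest_roots f); rewrite inE rr fk; lia.
Qed.

Definition free_legs_under f r :=
  [set l in free_legs f | top f (leg_vertex l) == r].

(** Among the (k + 1)! extensions there are k! that attach [r] to a given free
    leg outside its component; those rooted at [r] are the rest. *)
Theorem card_extensions_at k f r : acyclic f -> leg_inj f ->
  #|forest_roots f| = k.+2 -> is_root f r ->
  #|extensions_at f r| = (#|free_legs_under f r| * k`!)%N.
Proof.
move=> fa fi fk rr; have := card_extensions_split rr.
rewrite (card_extensions fa fi fk) (eq_bigr (fun=> k`!)) => [|l /andP[lf lr]].
  rewrite sum_nat_const; set d := #|extensions_at f r|; set c := #|_|.
  have : (#|free_legs_under f r| + c = k.+1)%N.
    have := card_free_legs fi; rewrite fk sum_in.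
    rewrite -(cardsID [set l | top f (leg_vertex l) == r] (free_legs f)).
    have -> : free_legs f :&: [set l | top f (leg_vertex l) == r] =
        free_legs_under f r by apply/setP=> l; rewrite !inE.
    have -> : #|free_legs f :\: [set l | top f (leg_vertex l) == r]| = c.
      by apply: eq_card => l; rewrite in_setD inE andbC [RHS]unfold_in.
    lia.
  rewrite factS => <-; rewrite mulnDl; lia.
apply: card_extensions; [exact: acyclic_attach | exact: leg_inj_attach |].
by rewrite roots_attach; have := cardsD1 r (forest_roots f); rewrite inE rr fk; lia.
Qed.

Theorem card_plane_tree : #|plane_tree i| = n.-1`!.
Proof.
pose f0 : plane_forest i := [ffun=> None].
have root0 v : is_root f0 v by rewrite /is_root ffunE.
rewrite -(@card_extensions n.-1 f0).
- by apply: eq_card => t; rewrite !inE; apply/esym/forallP => v; rewrite root0.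
- by apply/forallP=> v; apply: root0.
- by move=> v w l; rewrite ffunE.
rewrite prednK // -[RHS]card_ord; apply: eq_card => v; rewrite !inE; exact: root0.
Qed.

End PlaneTrees.

(** * Trees that agree on the occupied vertices *)

Section OccupiedForest.
Variables (n : nat) (i : 'I_n -> nat).
Implicit Types (t : plane_tree i) (l : leg i) (occ : {set 'I_n}).
Implicit Types (u v w r : 'I_n).

Lemma is_root_occupied (t : plane_forest i) occ v :
  is_root (occupied_forest t occ) v = (v \notin occ) || is_root t v.
Proof. by rewrite /is_root ffunE; case: (v \in occ). Qed.

Lemma subforest_occupied (t : plane_forest i) occ :
  subforest (occupied_forest t occ) t.
Proof.
apply/forallP=> v; rewrite is_root_occupied negb_or negbK ffunE.
by case: (v \in occ); rewrite ?eqxx ?implybT.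
Qed.

Lemma acyclic_occupied t occ : acyclic (occupied_forest (val t) occ).
Proof. exact: subforest_acyclic (subforest_occupied _ _) (tree_acyclic t). Qed.

Lemma leg_inj_subforest (f t : plane_forest i) :
  subforest f t -> leg_inj t -> leg_inj f.
Proof. by move=> ft ti v w l /(subforest_some ft) tv /(subforest_some ft) /(ti _ _ _ tv). Qed.

Lemma leg_inj_occupied t occ : leg_inj (occupied_forest (val t) occ).
Proof. exact: leg_inj_subforest (subforest_occupied _ _) (@tree_leg_inj _ _ t). Qed.

(** The trees that cannot be told apart from [t] by a parking process that has
    filled [occ]: such a process has followed the parent edges of occupied
    vertices only, including the missing one if the root is occupied. *)
Definition agreeing occ (t : plane_forest i) :=
  [set t' : plane_tree i | [forall v in occ, val t' v == t v]].

Lemma agreeing_refl occ t : t \in agreeing occ (val t).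
Proof. by rewrite inE; apply/forall_inP. Qed.

Lemma eq_occupied occ (t : plane_forest i) t' :
  t' \in agreeing occ t -> occupied_forest (val t') occ = occupied_forest t occ.
Proof.
rewrite inE => /forall_inP H; apply/ffunP=> v; rewrite !ffunE.
by case: ifP => // /H/eqP.
Qed.

Lemma eq_agreeing occ (t : plane_forest i) t' :
  t' \in agreeing occ t -> agreeing occ (val t') = agreeing occ t.
Proof.
rewrite inE => /forall_inP H; apply/setP=> t''; rewrite !inE.
by apply/forall_inP/forall_inP=> H' v vo; rewrite (eqP (H' v vo)) ?(eqP (H v vo)).
Qed.

Lemma agreeing_extensions occ t :
  (forall r, is_root (val t) r -> r \notin occ) ->
  agreeing occ (val t) = extensions (occupied_forest (val t) occ).
Proof.
move=> nor; apply/setP=> t'; rewrite !inE; apply/forallP/forallP => H v.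
  rewrite is_root_occupied negb_or negbK ffunE; have := H v.
  by case: ifP => //= _ ->; rewrite implybT.
apply/implyP=> vo; have := H v; rewrite is_root_occupied ffunE vo /=.
by case: (boolP (is_root _ _)) => // /nor; rewrite vo.
Qed.

Lemma agreeing_extensions_at occ t r : is_root (val t) r -> r \in occ ->
  agreeing occ (val t) = extensions_at (occupied_forest (val t) occ) r.
Proof.
move=> tr ro; apply/setP=> t'; rewrite !inE.
apply/forallP/andP => [H | [/forallP H t'r] v].
  split; last by have := H r; rewrite ro /is_root /= => /eqP->.
  apply/forallP=> v; rewrite is_root_occupied negb_or negbK ffunE; have := H v.
  by case: ifP => //= _ ->; rewrite implybT.
apply/implyP=> vo; have := H v; rewrite is_root_occupied ffunE vo /=.
case: (boolP (is_root (val t) v)) => // tv _.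
by rewrite (tree_root_unique tv tr) (eqP tr).
Qed.

Lemma card_roots_occupied occ t r : is_root (val t) r ->
  (#|forest_roots (occupied_forest (val t) occ)| + #|occ| = n + (r \in occ))%N.
Proof.
move=> tr; have := cardsC occ; rewrite card_ord; set F := occupied_forest _ _.
have -> : forest_roots F = ~: occ :|: [set r] :&: occ.
  apply/setP=> v; rewrite !inE is_root_occupied; case: (v \in occ) => //=.
  rewrite andbT; apply/idP/eqP => [/tree_root_unique/(_ tr) | ->] //.
rewrite cardsU; case: (boolP (r \in occ)) => ro.
  have -> : [set r] :&: occ = [set r] by apply/setIidPl; rewrite sub1set.
  have -> : ~: occ :&: [set r] = set0.
    by apply/eqP; rewrite setI_eq0 disjoint_sym disjoints1 !inE ro.
  by rewrite cards0 cards1 /=; move: #|occ| #|~: occ| => c c'; lia.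
have -> : [set r] :&: occ = set0 by apply/eqP; rewrite setI_eq0 disjoints1 ro.
by rewrite setI0 cards0 /=; move: #|occ| #|~: occ| => c c'; lia.
Qed.

Lemma tree_rootE t : exists r, is_root (val t) r.
Proof. by case/andP: (valP t) => /existsP[r /andP[rr _]] _; exists r. Qed.

Hypotheses (n_gt0 : (0 < n)%N) (sum_in : (\sum_k i k = n - 1)%N).

(** The parent of a free root [r] is each given in-leg outside its component
    and the component of the root with the same probability.  If the root is not
    revealed, both sides are factorials by [card_extensions].  If it is, both
    carry by [card_extensions_at] the same number of free legs below the root,
    because the leg [l] and the root [r] lie in other components. *)
Lemma card_agreeing_attach t occ r l :
  let F := occupied_forest (val t) occ in
  r \notin occ -> l \in free_legs F -> top F (leg_vertex l) \notin occ ->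
  top F (leg_vertex l) != r ->
  (#|[set t' in agreeing occ (val t) | val t' r == Some l]| * (n.-1 - #|occ|)
   = #|agreeing occ (val t)|)%N.
Proof.
move=> F ro lF lo lr.
have rr : is_root F r by rewrite is_root_occupied ro.
have Fa : acyclic F := acyclic_occupied t occ.
have Fi : leg_inj F := @leg_inj_occupied t occ.
have F'a := acyclic_attach Fa rr lr; have F'i := leg_inj_attach (r := r) Fi lF.
have [r0 tr0] := tree_rootE t; have := card_roots_occupied occ tr0; rewrite -/F.
have := cardsD1 r (forest_roots F); rewrite inE rr -(roots_attach F r l).
set k := #|forest_roots F|; set k' := #|forest_roots _| => kk' kE.
have K'E : [set t' in extensions F | val t' r == Some l] = extensions (attach F r l).
  by rewrite extensions_attach.
have [r0o | r0o] := boolP (r0 \in occ); last first.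
  rewrite agreeing_extensions => [|r' tr']; last first.
    by rewrite (tree_root_unique tr' tr0).
  rewrite K'E.
  have [m mE] : exists m, k' = m.+1.
    have : (0 < k')%N.
      apply/card_gt0P; exists (top F (leg_vertex l)).
      by rewrite inE attach_root lr is_root_top.
    by case: k' {kk'} => // m _; exists m.
  rewrite (card_extensions n_gt0 sum_in F'a F'i mE).
  rewrite (@card_extensions _ _ n_gt0 sum_in m.+1 F) //; last by rewrite -/k kk' mE.
  rewrite (negbTE r0o) in kE; rewrite factS mulnC; congr (_ * _)%N.
  by move: k k' #|occ| kk' kE mE => {}k {}k' c; clear; lia.
rewrite (agreeing_extensions_at tr0 r0o) -/F.
have r0r : r0 != r by apply: contraNneq ro => <-.
have rr0 : is_root F r0 by rewrite is_root_occupied tr0 orbT.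
have rr0' : is_root (attach F r l) r0 by rewrite attach_root r0r.
have -> : [set t' in extensions_at F r0 | val t' r == Some l] =
          extensions_at (attach F r l) r0.
  by rewrite /extensions_at -K'E; apply/setP=> t'; rewrite !inE andbAC.
have lr0 : top F (leg_vertex l) != r0 by apply: contraNneq lo => ->.
have [m mE] : exists m, k' = m.+2.
  have : [set r0; top F (leg_vertex l)] \subset forest_roots (attach F r l).
    apply/subsetP=> v; rewrite !inE => /orP[/eqP-> // | /eqP->].
    by rewrite attach_root lr is_root_top.
  move/subset_leq_card; rewrite cards2 eq_sym lr0 -/k'.
  by case: k' {kk'} => [|[|m]] // _; exists m.
rewrite (card_extensions_at n_gt0 sum_in F'a F'i mE rr0').
rewrite (@card_extensions_at _ _ n_gt0 sum_in m.+1 F) //; last by rewrite -/k kk' mE.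
have -> : free_legs_under (attach F r l) r0 = free_legs_under F r0.
  apply/setP=> l'; rewrite /free_legs_under free_legs_attach //.
  rewrite !in_set in_set1 top_attach //.
  rewrite -andbA; case: (eqVneq l' l) => [-> | _] /=.
    by rewrite (negbTE lr0) andbF.
  congr (_ && _); case: (eqVneq (top F (leg_vertex l')) r) => // ->.
  by rewrite (negbTE lr0) eq_sym (negbTE r0r).
rewrite r0o in kE; rewrite factS -mulnA; congr (_ * _)%N.
rewrite mulnC; congr (_ * _)%N.
by move: k k' #|occ| kk' kE mE => {}k {}k' c; clear; lia.
Qed.

End OccupiedForest.

(** * Parking and the forest of nearly parked components *)

Section ParkingForest.
Variables (n : nat) (i a : 'I_n -> nat).
Implicit Types (t : plane_tree i) (occ : {set 'I_n}) (p : parking_state a).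
Implicit Types (u v w r : 'I_n) (c : leg a).

(** A car drives along edges of the occupied forest until it meets a vertex that
    is free or that is the root of the tree: in both cases, the root of its
    component. *)
Lemma first_freeE t occ v (F := occupied_forest (val t) occ) :
  first_free n (val t) occ v = if top F v \in occ then None else Some (top F v).
Proof.
suff gen m : is_root F (iter m (parent F) v) ->
    first_free m (val t) occ v = if iter m (parent F) v \in occ then None
                                 else Some (iter m (parent F) v).
  by apply: gen; apply: is_root_top; apply: acyclic_occupied.
have free w : w \notin occ -> is_root F w by rewrite is_root_occupied => ->.
elim: m v => [|m IHm] v; first by rewrite /=; case: (v \in occ).
case: (boolP (v \in occ)) => vo; last first.
  by rewrite [LHS]/= vo iter_parent_root ?free // (negbTE vo).
rewrite iterSr [first_free _ _ _ _]/= vo /=.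
have -> : parent F v = parent (val t) v by rewrite /parent ffunE vo.
rewrite /parent; case tv: (val t v) => [l|]; first exact: IHm.
by move=> _; rewrite iter_parent_root ?vo // is_root_occupied /is_root tv orbT.
Qed.

Lemma park_carE t p c (F := occupied_forest (val t) (occupied p)) :
  park_car (val t) p c =
  if top F (leg_vertex c) \in occupied p
  then ParkingState (occupied p) (c |: exited p)
  else ParkingState (top F (leg_vertex c) |: occupied p) (exited p).
Proof. by rewrite /park_car first_freeE -/F; case: (_ \in _). Qed.

Lemma occupied_park_car t p c : occupied p \subset occupied (park_car (val t) p c).
Proof. by rewrite park_carE; case: ifP => _ //=; apply: subsetUr. Qed.

Lemma agreeingW t t' occ occ' : occ \subset occ' ->
  t' \in agreeing occ' (val t) -> t' \in agreeing occ (val t).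
Proof.
by move=> /subsetP oo; rewrite !inE => /forall_inP H; apply/forall_inP=> v /oo/H.
Qed.

(** Occupied vertices stay occupied, so that all parent edges that were ever
    used by a car leave vertices that are occupied in the end. *)
Lemma park_agreeing t t' (cars : seq (leg a)) :
  t' \in agreeing (occupied (park (val t) cars)) (val t) ->
  park (val t') cars = park (val t) cars.
Proof.
elim/last_ind: cars => // cars c IHcars.
rewrite /park !foldl_rcons -!/(park _ _) => H.
have {}H := agreeingW (occupied_park_car _ _ _) H.
by rewrite IHcars // !park_carE (eq_occupied H).
Qed.

Lemma np_componentE t occ v (F := occupied_forest (val t) occ) :
  np_component (val t) occ v = [set w | top F w == top F v].
Proof.
by rewrite /np_component weak_component_forest //; apply: acyclic_occupied.
Qed.

Lemma root_componentE t occ r : is_root (val t) r ->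
  root_component (val t) occ =
  if r \in occ then Some (np_component (val t) occ r) else None.
Proof.
move=> tr; rewrite /root_component; case: pickP => [r' /andP[r'o tr'] | none] /=.
  by rewrite (tree_root_unique tr tr') r'o.
by have := none r; rewrite /= tr andbT => ->.
Qed.

(** If the root is revealed, its component has only one vertex without a parent
    in the forest, which has to be the root of any tree containing it. *)
Lemma contains_forestE t t' occ :
  contains_forest (np_forest (val t) occ) (val t') = (t' \in agreeing occ (val t)).
Proof.
have [r tr] := tree_rootE t; set F := occupied_forest (val t) occ.
rewrite /contains_forest /= (root_componentE occ tr) -/F -/(subforest F (val t')).
case: (boolP (r \in occ)) => ro.
  rewrite (agreeing_extensions_at tr ro) !inE; apply: andb_id2l => ft'.
  have rr : is_root F r by rewrite is_root_occupied tr orbT.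
  apply/existsP/idP => [[r' /andP[]] | t'r]; last first.
    by exists r; rewrite t'r np_componentE inE eqxx.
  rewrite np_componentE inE -/F (top_root rr) => /eqP r'r t'r'.
  by rewrite -r'r top_root // (subforest_root ft').
rewrite andbT agreeing_extensions ?inE // => r' tr'.
by rewrite (tree_root_unique tr' tr).
Qed.

Lemma eq_np_forest t t' occ : t' \in agreeing occ (val t) ->
  np_forest (val t') occ = np_forest (val t) occ.
Proof.
move=> H; rewrite /np_forest /root_component /np_component (eq_occupied H).
congr (_, omap _ _); apply: eq_pick => r; case: (boolP (r \in occ)) => //= ro.
by move: H; rewrite inE /is_root => /forall_inP/(_ _ ro)/eqP->.
Qed.

End ParkingForest.

(** * The invariant of the coupling *)

Section Coupling.
Variables (n : nat) (i a : 'I_n -> nat).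
Implicit Types (t : plane_tree i) (f : plane_forest i).
Implicit Types (m : {ffun leg a -> option (leg i)}).
Implicit Types (s : fcm_state i a) (p : parking_state a).
Implicit Types (u v w r : 'I_n) (x : leg a) (l : leg i) (y : option (leg i)).
Implicit Types (occ : {set 'I_n}).

(** What ties the two constructions together, when the same out-legs have been
    treated and [f] is the forest of edges leaving occupied vertices.  The
    matching is not [f]: a car that arrives on u parks on the root r of its
    component and reveals the edge leaving r, while its out-leg leaves u; only
    the components agree.  Nor do the in-legs of blue vertices that are used by
    [f] and by the matching agree, but each parked car uses one unmatched
    in-leg, as long as there is one left, whence the truncated subtraction in
    [coupled_card]. *)
Record coupled f s p : Prop := Coupled {
  coupled_exited : deleted s = exited p;
  coupled_blue : forall v, (v \in blue s) = (top f v \in occupied p);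
  coupled_white : forall v, v \notin blue s ->
    weak_component (fcm_edge (matching s)) v = [set w | top f w == top f v];
  coupled_legs : forall l, leg_vertex l \notin blue s ->
    (l \in unmatched_in s) = (l \in free_legs f);
  coupled_card : #|unmatched_in s| = (n.-1 - #|occupied p|)%N;
  coupled_fresh : forall x, x \notin treated s -> matching s x = None
}.

Definition match_legs m x y : {ffun leg a -> option (leg i)} :=
  [ffun z => if z == x then y else m z].

Lemma fcm_edge_match m x y v w : m x = None ->
  fcm_edge (match_legs m x y) v w =
  fcm_edge m v w || (v == leg_vertex x) && (omap (@leg_vertex n i) y == Some w).
Proof.
move=> mx; rewrite /fcm_edge /=; apply/existsP/orP.
  case=> z; rewrite ffunE; case: (z =P x) => [-> | _] /andP[zv zw].
    by right; rewrite eq_sym zv.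
  by left; apply/existsP; exists z; rewrite zv.
case=> [/existsP[z /andP[zv zw]] | /andP[/eqP-> yw]].
  exists z; rewrite zv ffunE; case: (z =P x) => // E.
  by move: zw; rewrite E mx.
by exists x; rewrite ffunE !eqxx.
Qed.

Lemma unmatched_in_match s x y trd del b : matching s x = None ->
  unmatched_in (FcmState (match_legs (matching s) x y) trd del b) =
  unmatched_in s :\: [set l | y == Some l].
Proof.
move=> mx; apply/setP=> l; rewrite !inE /=.
apply/forallP/andP => [H | [yl /forallP H] z].
  split; first by have := H x; rewrite ffunE eqxx.
  apply/forallP=> z; have := H z; rewrite ffunE.
  by case: (z =P x) => // ->; rewrite mx.
by rewrite ffunE; case: (z =P x).
Qed.

Definition freezing_legs s u :=
  [set l in unmatched_in s |
    (leg_vertex l \in blue s) ||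
    (leg_vertex l \in weak_component (fcm_edge (matching s)) u)].

Lemma mem_freezing_legs s u l : (l \in freezing_legs s u) =
  (l \in unmatched_in s) && ((leg_vertex l \in blue s) ||
    (leg_vertex l \in weak_component (fcm_edge (matching s)) u)).
Proof. by rewrite in_set. Qed.

Definition freezes s u y :=
  if y is Some l then l \in freezing_legs s u else unmatched_in s == set0.

Section Step.
Variables (f : plane_forest i) (s : fcm_state i a) (p : parking_state a).
Variable x : leg a.
Hypotheses (fa : acyclic f) (cpl : coupled f s p).
Hypotheses (x_fresh : x \notin treated s) (x_white : leg_vertex x \notin blue s).

Let u := leg_vertex x.
Let r := top f u.
Let wc := weak_component (fcm_edge (matching s)).

Lemma coupled_free : r \notin occupied p.
Proof. by rewrite -(coupled_blue cpl). Qed.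

Let rr : is_root f r. Proof. exact: is_root_top. Qed.

Let mx : matching s x = None. Proof. exact: (coupled_fresh cpl). Qed.

Let wcu : wc u = [set w | top f w == r].
Proof. exact: (coupled_white cpl). Qed.

Lemma white_class v w : v \notin blue s -> w \in wc v = (top f w == top f v).
Proof. by move=> vb; rewrite /wc (coupled_white cpl) // inE. Qed.

Lemma white_top v : v \notin blue s -> top f v \notin occupied p.
Proof. by rewrite (coupled_blue cpl). Qed.

(** The partner of the out-leg is the in-leg that the root [r] of its component
    is attached to: both constructions merge the same two components. *)
Lemma coupled_match l : l \in unmatched_in s -> leg_vertex l \notin blue s ->
  top f (leg_vertex l) != r ->
  coupled (attach f r l)
    (FcmState (match_legs (matching s) x (Some l)) (x |: treated s) (deleted s)
      (blue s))
    (ParkingState (r |: occupied p) (exited p)).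
Proof.
move=> lU lb lr; have ro := coupled_free.
have lo := white_top lb.
split=> /=.
- exact: coupled_exited cpl.
- move=> v; rewrite (coupled_blue cpl) top_attach // !inE.
  case: (eqVneq (top f v) r) => [-> | vr]; last by rewrite (negbTE vr).
  by rewrite (negbTE lr) (negbTE lo) (negbTE ro).
- move=> v vb; apply/setP=> w.
  have e'E z z' : fcm_edge (match_legs (matching s) x (Some l)) z z' =
      fcm_edge (matching s) z z' || (z == u) && (z' == leg_vertex l).
    by rewrite fcm_edge_match //= [Some _ == _]eq_sym.
  rewrite (weak_component_add _ _ e'E) [RHS]inE !top_attach //.
  rewrite -/wc !white_class // -/r.
  case: (eqVneq (top f v) r) => [-> | vr];
    case: (eqVneq (top f w) r) => [-> | wr] /=;
    rewrite ?eqxx ?(negbTE lr) ?andbF ?orbF ?orbT //=.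
  by rewrite (eq_sym r) (negbTE vr) andbT.
- move=> l' l'b; rewrite unmatched_in_match // free_legs_attach // !in_setD in_set1 inE.
  by rewrite (coupled_legs cpl) // (inj_eq (@Some_inj _)) eq_sym.
- rewrite unmatched_in_match // cardsU1 ro.
  have -> : [set l' | Some l == Some l'] = [set l].
    by apply/setP=> l'; rewrite !inE (inj_eq (@Some_inj _)) eq_sym.
  have := cardsD1 l (unmatched_in s); rewrite lU (coupled_card cpl).
  by move: #|_ :\ _| #|_| => c c' /=; lia.
- move=> z; rewrite !inE negb_or ffunE => /andP[/negbTE-> zt].
  exact: (coupled_fresh cpl).
Qed.

(** The component of the out-leg joins the blue vertices, wherever its partner
    [y] is among the in-legs that freeze it.  In the tree, [r] is the root or is
    attached to a component whose root is occupied: [f'] stands for the forest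
    in both cases, [r1] being the root that the vertices below [r] get. *)
Lemma coupled_freeze f' r1 y :
    freezes s u y ->
    r1 \in r |: occupied p ->
    (forall v, top f' v = if top f v == r then r1 else top f v) ->
    (forall l, leg_vertex l \notin blue s ->
       (l \in free_legs f') = (l \in free_legs f)) ->
  coupled f'
    (FcmState (match_legs (matching s) x y) (x |: treated s) (deleted s)
      (blue s :|: weak_component (fcm_edge (match_legs (matching s) x y)) u))
    (ParkingState (r |: occupied p) (exited p)).
Proof.
rewrite /freezes => Hy r1o f'top f'legs; have ro := coupled_free.
pose wc' := weak_component (fcm_edge (match_legs (matching s) x y)).
have wc'N : y = None -> wc' =1 wc.
  move=> yN v; apply/setP=> w; rewrite !inE; apply: eq_connect => z z' /=.
  by rewrite !fcm_edge_match // yN /= !andbF !orbF.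
have wc'S l v w : y = Some l -> (w \in wc' v) =
    [|| w \in wc v, (u \in wc v) && (w \in wc (leg_vertex l)) |
        (leg_vertex l \in wc v) && (w \in wc u)].
  move=> yl; apply: weak_component_add => z z'.
  by rewrite fcm_edge_match // yl /= [Some _ == _]eq_sym.
have blueE : blue s :|: wc' u = blue s :|: wc u.
  apply/setP=> w; rewrite 2!in_setU; case yE: y Hy => [l|]; last by rewrite wc'N.
  rewrite mem_freezing_legs => /andP[_ lbu].
  rewrite (wc'S l) // mem_weak_component /=.
  case: (boolP (w \in blue s)) => //= wb; case: (boolP (w \in wc u)) => //= wu.
  rewrite andbF orbF; apply/negP => lw; case/orP: lbu => [lb | lu]; last first.
    by case/negP: wu; apply: weak_component_trans lw.
  move: lw; rewrite weak_component_sym -/wc white_class // => /eqP E.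
  by move: lb; rewrite (coupled_blue cpl) E (negbTE (white_top wb)).
have vbu v : v \notin blue s :|: wc u ->
    [/\ v \notin blue s, top f v != r & wc' v = wc v].
  rewrite in_setU negb_or wcu inE => /andP[vb vr]; split => //.
  case yE: y Hy => [l|] Hy; last by rewrite wc'N.
  move: Hy; rewrite mem_freezing_legs => /andP[_ lbu].
  apply/setP=> w; rewrite (wc'S l) //.
  rewrite [u \in _]white_class // (eq_sym (top f u)) (negbTE vr) /=.
  suff -> : leg_vertex l \in wc v = false by rewrite orbF.
  apply/negP; rewrite white_class // => /eqP E; case/orP: lbu.
    by rewrite (coupled_blue cpl) E (negbTE (white_top vb)).
  by rewrite -/(wc _) wcu inE E (negbTE vr).
split=> /=; rewrite -/wc' ?blueE.
- exact: coupled_exited cpl.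
- move=> v; rewrite f'top in_setU (coupled_blue cpl) wcu !inE.
  case: (eqVneq (top f v) r) => [-> | vr] /=; last by rewrite orbF (negbTE vr).
  by rewrite orbT; apply/esym; move: r1o; rewrite !inE.
- move=> v vN; case: (vbu _ vN) => vb vr ->; apply/setP=> w.
  rewrite white_class // inE !f'top (negbTE vr).
  case: (eqVneq (top f w) r) => // ->; rewrite eq_sym (negbTE vr); apply/esym/negbTE.
  apply: contraTneq r1o => ->; rewrite !inE (negbTE vr) /=; exact: white_top.
- move=> l lN; have [lb lr _] := vbu _ lN; rewrite f'legs // -(coupled_legs cpl) //.
  rewrite unmatched_in_match // in_setD inE.
  suff -> : (y == Some l) = false by [].
  apply/negP=> /eqP yl; move: Hy lN.
  by rewrite yl in_setU mem_freezing_legs => /andP[_ ->].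
- rewrite unmatched_in_match // cardsU1 ro /=; case yE: y Hy => [l|] Hy.
    have -> : [set l' | Some l == Some l'] = [set l].
      by apply/setP=> l'; rewrite !inE (inj_eq (@Some_inj _)) eq_sym.
    move: Hy; rewrite mem_freezing_legs => /andP[lU _].
    have := cardsD1 l (unmatched_in s); rewrite lU (coupled_card cpl).
    by move: #|_ :\ _| #|_| => c c' /=; lia.
  have := coupled_card cpl; rewrite (eqP Hy) set0D cards0.
  by move: #|_| => c; lia.
- move=> z; rewrite !inE negb_or ffunE => /andP[/negbTE-> zt].
  exact: (coupled_fresh cpl).
Qed.

End Step.

(** Given the tree, the partner of a white out-leg going out from [u] is uniform
    in this set.  It is the parent leg of the root of the component of [u] when
    the choice of this leg does not freeze the component; otherwise the tree
    says only that the component freezes, and any leg with this effect is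
    equally likely. *)
Definition admissible_legs t s p u : {set leg i} :=
  if val t (top (occupied_forest (val t) (occupied p)) u) is Some l then
    if l \in unmatched_in s :\: freezing_legs s u then [set l]
    else freezing_legs s u
  else freezing_legs s u.

Lemma occupied_forest_attach t occ r l :
  r \notin occ -> val t r = Some l ->
  occupied_forest (val t) (r |: occ) = attach (occupied_forest (val t) occ) r l.
Proof.
move=> ro tr; apply/ffunP=> v; rewrite !ffunE !inE.
by case: (v =P r) => [-> | _].
Qed.

Lemma occupied_forest_root t occ r : r \notin occ -> is_root (val t) r ->
  occupied_forest (val t) (r |: occ) = occupied_forest (val t) occ.
Proof.
move=> ro /eqP tr; apply/ffunP=> v; rewrite !ffunE !inE.
by case: (v =P r) => [-> | _] //; rewrite tr (negbTE ro).
Qed.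

Lemma tree_leg_free t occ r l : r \notin occ -> val t r = Some l ->
  l \in free_legs (occupied_forest (val t) occ).
Proof.
move=> ro tr; rewrite inE; apply/forallP=> v; rewrite ffunE; case: ifP => // vo.
by apply: contraNneq ro => /(@tree_leg_inj _ _ t)/(_ tr) <-.
Qed.

Lemma coupled_step t s p x y
    (p' := park_car (val t) p x) (s' := fcm_step s (x, y)) :
    coupled (occupied_forest (val t) (occupied p)) s p -> x \notin treated s ->
    (if (leg_vertex x \in blue s) then y == None else
     if unmatched_in s == set0 then y == None else
     if y is Some l then l \in admissible_legs t s p (leg_vertex x) else false) ->
  coupled (occupied_forest (val t) (occupied p')) s' p'.
Proof.
rewrite {}/p' {}/s' park_carE; set F := occupied_forest _ _ => cpl xt.
set u := leg_vertex x; set r := top F u.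
rewrite /fcm_step -/u -(coupled_blue cpl).
case: (boolP (u \in blue s)) => [ub _ | ub].
  case: cpl => C1 C2 C3 C4 C5 C6; split=> //=; first by rewrite C1.
  by move=> z; rewrite inE negb_or => /andP[_ /C6].
rewrite /= => Hy; have ro := coupled_free cpl ub.
have fa : acyclic F := acyclic_occupied t (occupied p).
have rr : is_root F r := is_root_top u fa.
have tr_free l : val t r = Some l ->
    (l \in free_legs F) && (top F (leg_vertex l) != r).
  move=> tr; rewrite (tree_leg_free ro tr).
  exact: subforest_parent_top (tree_acyclic t) (subforest_occupied _ _) rr tr.
have wcu w : w \in weak_component (fcm_edge (matching s)) u = (top F w == r).
  by rewrite (white_class cpl).
have tr_blue l : val t r = Some l -> l \notin unmatched_in s :\: freezing_legs s u ->
    leg_vertex l \in blue s.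
  move=> /tr_free/andP[lF lr].
  rewrite !in_setD mem_freezing_legs wcu (negbTE lr) orbF.
  by apply: contraR => lb; rewrite (coupled_legs cpl) // lF lb.
have freeze : freezes s u y ->
    (forall l, val t r = Some l -> leg_vertex l \in blue s) ->
    coupled (occupied_forest (val t) (r |: occupied p))
      (FcmState (match_legs (matching s) x y) (x |: treated s) (deleted s)
        (blue s :|: weak_component (fcm_edge (match_legs (matching s) x y)) u))
      (ParkingState (r |: occupied p) (exited p)).
  move=> Hy' trb.
  case tr: (val t r) => [l|].
    have lb := trb _ tr; have /andP[lF lr] := tr_free _ tr.
    rewrite (occupied_forest_attach ro tr).
    apply: (coupled_freeze fa cpl xt ub Hy' (r1 := top F (leg_vertex l))).
    - by rewrite inE -(coupled_blue cpl) lb orbT.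
    - exact: top_attach.
    move=> l' l'b; rewrite free_legs_attach // in_setD1.
    by case: (eqVneq l' l) => // E; rewrite E lb in l'b.
  rewrite occupied_forest_root // ?/is_root ?tr //.
  apply: (coupled_freeze fa cpl xt ub Hy' (r1 := r)) => //; first by rewrite setU11.
  by move=> v; case: eqP.
case: ifP Hy => [U0 /eqP yN | /negbT U0].
  move: freeze; rewrite yN; apply => // l /tr_blue; apply.
  by rewrite (eqP U0) set0D inE.
case: y freeze => // l freeze; rewrite /admissible_legs -/F -/r.
case tr: (val t r) => [l0|].
  case: ifP => [l0U | /negbT/(tr_blue _ tr) l0b].
    rewrite inE => /eqP ->; have /andP[lF lr] := tr_free _ tr.
    rewrite (occupied_forest_attach ro tr).
    move: l0U; rewrite in_setD mem_freezing_legs wcu (negbTE lr) orbF.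
    case/andP=> + l0U; rewrite l0U /= => l0b; rewrite (negbTE l0b).
    exact: coupled_match.
  move=> lA; have := lA; rewrite mem_freezing_legs => /andP[_ ->].
  by apply: freeze => // l1; rewrite tr => -[<-].
move=> lA; have := lA; rewrite mem_freezing_legs => /andP[_ ->].
by apply: freeze => // l1; rewrite tr.
Qed.

Lemma coupled_init t : (0 < n)%N -> (\sum_k i k = n - 1)%N ->
  coupled (occupied_forest (val t) set0) (fcm_init i a) (ParkingState set0 set0).
Proof.
move=> n_gt0 sum_in; set F := occupied_forest _ _.
have rt v : is_root F v by rewrite is_root_occupied inE.
split=> //=.
- by move=> v; rewrite !inE.
- move=> v _; apply/setP=> w; rewrite [RHS]inE !top_root //.
  apply/idP/eqP => [/weak_component_ind E | ->]; last exact: mem_weak_component.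
  apply/esym; apply: (E _ id) => z z' /existsP[c]; rewrite ffunE andbF //.
- move=> l _; rewrite !inE; apply/forallP/forallP => _ v; rewrite ffunE ?inE //.
- have -> : unmatched_in (fcm_init i a) = setT.
    by apply/setP=> l; rewrite !inE; apply/forallP=> z; rewrite ffunE.
  by rewrite cardsT card_leg cards0 sum_in; lia.
by move=> z _; rewrite ffunE.
Qed.

End Coupling.

(** * Uniform laws and sums over sequences *)

Section Sums.
Variable R : realFieldType.

Lemma unif_ge0 (A : finType) (B : {set A}) x : 0 <= unif R B x.
Proof. by rewrite /unif; case: ifP => // _; rewrite invr_ge0 ler0n. Qed.

Lemma sum_unif (A : finType) (B : {set A}) : B != set0 -> \sum_x unif R B x = 1.
Proof.
move=> B0; rewrite /unif -big_mkcond sumr_const -[_ *+ _]mulr_natr mulVf //.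
by rewrite pnatr_eq0 cards_eq0.
Qed.

Lemma big_tuple_nil (A : finType) (P : pred (seq A)) (F : seq A -> R) :
  \sum_(s : 0.-tuple A | P s) F s = if P [::] then F [::] else 0.
Proof.
by rewrite big_mkcond (big_pred1 [tuple]) //= => s; apply/esym/eqP/tuple0.
Qed.

Lemma big_tuple_cons (A : finType) m (P : pred (seq A)) (F : seq A -> R) :
  \sum_(s : m.+1.-tuple A | P s) F s =
  \sum_x \sum_(s : m.-tuple A | P (x :: s)) F (x :: s).
Proof.
rewrite pair_big_dep /=.
rewrite (reindex (fun q : A * m.-tuple A => [tuple of q.1 :: q.2])) //=.
exists (fun s : m.+1.-tuple A => (thead s, [tuple of behead s])) => [[x s]|s] _.
  by rewrite theadE; congr (_, _); apply: val_inj.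
by rewrite [RHS]tuple_eta.
Qed.

End Sums.

(** * The coupled law *)

Section CoupledLaw.
Variables (R : realFieldType) (n : nat) (i a : 'I_n -> nat).
Implicit Types (t : plane_tree i) (occ : {set 'I_n}).
Implicit Types (s : fcm_state i a) (p : parking_state a).
Implicit Types (u v w r : 'I_n) (x : leg a) (l : leg i) (y : option (leg i)).
Implicit Types (tr : seq (leg a * option (leg i))).

Local Notation step := (leg a * option (leg i))%type.
Local Notation out_legs tr := [seq xy.1 | xy <- tr].
Local Notation forest t p := (occupied_forest (val t) (occupied p)).

(** The law of a step of the frozen configuration model, with the uniform choice
    among the unmatched in-legs conditioned by the tree. *)
Definition coupled_step_prob t s p (xy : step) : R :=
  let: (x, y) := xy in
  unif R (untreated s) x *
  (if (leg_vertex x \in blue s) || (unmatched_in s == set0) then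
     if y is None then 1 else 0
   else
     if y is Some l then unif R (admissible_legs t s p (leg_vertex x)) l else 0).

Fixpoint coupled_prob_from t s p tr : R :=
  if tr is xy :: tr' then
    coupled_step_prob t s p xy *
    coupled_prob_from t (fcm_step s xy) (park_car (val t) p xy.1) tr'
  else 1.

Lemma coupled_step_prob_ge0 t s p xy : 0 <= coupled_step_prob t s p xy.
Proof.
case: xy => x y; rewrite mulr_ge0 ?unif_ge0 //.
by case: ifP => _; case: y => *; rewrite ?ler01 ?unif_ge0.
Qed.

Lemma coupled_prob_from_ge0 t s p tr : 0 <= coupled_prob_from t s p tr.
Proof.
by elim: tr s p => //= xy tr IHtr s p; rewrite mulr_ge0 ?coupled_step_prob_ge0.
Qed.

Lemma coupled_stepW t s p x y :
    coupled (forest t p) s p -> coupled_step_prob t s p (x, y) != 0 ->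
  let p' := park_car (val t) p x in
  coupled (forest t p') (fcm_step s (x, y)) p'.
Proof.
move=> cpl; rewrite mulf_eq0 negb_or => /andP[xU yP]; apply: coupled_step => //.
  by move: xU; rewrite /unif !inE; case: (x \in treated s); rewrite //= eqxx.
move: yP; case: (leg_vertex x \in blue s) => /=; first by case: (y); rewrite ?eqxx.
case: (unmatched_in s == set0); first by case: (y); rewrite ?eqxx.
by case: (y) => [l|]; rewrite ?eqxx // /unif; case: (l \in _); rewrite ?eqxx.
Qed.

Lemma coupled_run t s p tr :
    coupled (forest t p) s p -> coupled_prob_from t s p tr != 0 ->
  let p' := foldl (park_car (val t)) p (out_legs tr) in
  coupled (forest t p') (foldl (@fcm_step n i a) s tr) p'.
Proof.
elim: tr s p => //= -[x y] tr IHtr s p cpl; rewrite mulf_eq0 negb_or => /andP[st pt].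
by apply: IHtr => //; apply: coupled_stepW.
Qed.

Lemma treated_step s x y : treated (fcm_step s (x, y)) = x |: treated s.
Proof. by rewrite /fcm_step; case: ifP. Qed.

(** The trees in [K] are those that are still possible after [p]. *)
Section Fibre.
Variables (t : plane_tree i) (s : fcm_state i a) (p : parking_state a).
Variable u : 'I_n.
Hypotheses (n_gt0 : (0 < n)%N) (sum_in : (\sum_k i k = n - 1)%N).
Hypotheses (cpl : coupled (forest t p) s p) (ub : u \notin blue s).

Let F := forest t p.
Let r := top F u.
Let K := agreeing (occupied p) (val t).
Let A := freezing_legs s u.

Lemma admissible_legsE t' : t' \in K ->
  admissible_legs t' s p u =
  if val t' r \in [set Some l | l in unmatched_in s :\: A]
  then [set l | val t' r == Some l] else A.
Proof.
move=> t'K; rewrite /admissible_legs (eq_occupied t'K) -/F -/r -/A.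
case t'r: (val t' r) => [l|]; last first.
  by case: imsetP => // -[l _].
rewrite mem_imset; last exact: Some_inj; case: ifP => // _.
by apply/setP=> l'; rewrite !inE (inj_eq (@Some_inj _)) eq_sym.
Qed.

Lemma card_fibre_leg l : l \in unmatched_in s :\: A ->
  (#|[set t' in K | val t' r == Some l]| * #|unmatched_in s| = #|K|)%N.
Proof.
rewrite in_setD mem_freezing_legs => /andP[+ lU]; rewrite lU negb_or => /andP[lb lu].
rewrite (coupled_card cpl) card_agreeing_attach //.
- by rewrite -(coupled_blue cpl).
- by rewrite -(coupled_legs cpl).
- by rewrite -(coupled_blue cpl).
by rewrite (white_class cpl) in lu.
Qed.

Definition unsettled :=
  [set t' in K | val t' r \notin [set Some l | l in unmatched_in s :\: A]].

(** Each leg that does not freeze the component is the parent leg of [r] in a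
    fraction 1 / #|unmatched_in s| of [K], by [card_fibre_leg]; the unsettled
    trees are the other ones. *)
Lemma card_unsettled : (#|unsettled| * #|unmatched_in s| = #|K| * #|A|)%N.
Proof.
have AU : A \subset unmatched_in s.
  by apply/subsetP=> l; rewrite mem_freezing_legs => /andP[].
have KE : #|K| = (#|unsettled| +
    \sum_(l in unmatched_in s :\: A) #|[set t' in K | val t' r == Some l]|)%N.
  pose B := [set Some l | l in unmatched_in s :\: A].
  rewrite -(cardsID [set t' : plane_tree i | val t' r \in B] K).
  rewrite addnC; congr (_ + _)%N; first by apply: eq_card => t'; rewrite !inE andbC.
  rewrite -sum1_card (partition_big (fun t' => val t' r) (mem B)) /=; last first.
    by move=> t' /setIP[_]; rewrite in_set.
  rewrite /B big_imset /=; last by move=> l l' _ _; apply: Some_inj.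
  apply: eq_bigr => l lB; rewrite sum1_card; apply: eq_card => t'.
  rewrite [LHS]unfold_in in_setI !in_set -andbA; congr (_ && _).
  by case: eqP => [->|_]; rewrite ?andbF // andbT; apply: imset_f.
have := congr1 (muln^~ #|unmatched_in s|) KE; rewrite mulnDl big_distrl /=.
rewrite (eq_bigr (fun=> #|K|)); last by move=> l; apply: card_fibre_leg.
rewrite sum_nat_const mulnC -(cardsID A (unmatched_in s)) (setIidPr AU).
by rewrite mulnDl [(#|A| * _)%N]mulnC => /addIn->.
Qed.

(** If no leg freezes the component of [u], then by [card_unsettled] the tree
    attaches it to another white component. *)
Lemma admissible_legs_neq0 :
  unmatched_in s != set0 -> admissible_legs t s p u != set0.
Proof.
move=> U0; rewrite admissible_legsE ?agreeing_refl //.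
case: ifPn => [/imsetP[l _ tr]|H].
  by apply/set0Pn; exists l; rewrite inE tr.
apply: contraNneq U0 => A0; have := card_unsettled; rewrite -/A A0 cards0 muln0.
move/eqP; rewrite muln_eq0 !cards_eq0 => /orP[/eqP/setP/(_ t)|//].
by rewrite [in LHS]inE agreeing_refl H inE.
Qed.

(** Averaged over the possible trees, the partner of the out-leg is uniform.  A
    freezing leg is drawn, with probability 1 / #|A|, for the unsettled trees
    only; any other leg is drawn for the trees where it is the parent leg of
    [r]. *)
Lemma sum_unif_admissible l : unmatched_in s != set0 ->
  \sum_(t' in K) unif R (admissible_legs t' s p u) l =
  #|K|%:R * unif R (unmatched_in s) l.
Proof.
move=> U0; have U0' : #|unmatched_in s|%:R != 0 :> R by rewrite pnatr_eq0 cards_eq0.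
pose B := [set Some l | l in unmatched_in s :\: A].
have [lA | lA] := boolP (l \in A).
  have A0 : #|A|%:R != 0 :> R by rewrite pnatr_eq0 -lt0n; apply/card_gt0P; exists l.
  have lU : l \in unmatched_in s by move: lA; rewrite mem_freezing_legs => /andP[].
  rewrite (eq_bigr (fun t' => if val t' r \notin B then #|A|%:R^-1 else 0)); last first.
    move=> t' t'K; rewrite admissible_legsE // -/B.
    case: ifPn => [|_] /=; last by rewrite /unif lA.
    case/imsetP=> l' + E; rewrite in_setD /unif inE E => /andP[l'A _].
    by case: eqP => // -[El]; rewrite El lA in l'A.
  rewrite -big_mkcondr sumr_const /= /unif lU -[_ *+ _]mulr_natl.
  have -> : #|[pred t' | t' \in K & val t' r \notin B]| = #|unsettled|.
    by apply: eq_card => t'; rewrite !inE.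
  by apply/eqP; rewrite eqr_div // -!natrM card_unsettled.
have [lU | lU] := boolP (l \in unmatched_in s); last first.
  rewrite {2}/unif (negbTE lU) mulr0 big1 // => t' t'K.
  rewrite admissible_legsE // -/B.
  case: ifPn => [|_] /=; last by rewrite /unif (negbTE lA).
  case/imsetP=> l' + E; rewrite in_setD /unif inE E => /andP[_ l'U].
  by case: eqP => // -[El]; rewrite -El l'U in lU.
have lB : l \in unmatched_in s :\: A by rewrite in_setD lA.
rewrite (eq_bigr (fun t' => if val t' r == Some l then 1 else 0)); last first.
  move=> t' t'K; rewrite admissible_legsE // -/B; case: ifPn => [|H] /=.
    case/imsetP=> l' _ E; rewrite /unif inE E; case: eqP => // El.
    have -> : [set l0 | Some l' == Some l0] = [set l'].
      by apply/setP=> l0; rewrite !inE (inj_eq (@Some_inj _)) eq_sym.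
    by rewrite cards1 invr1.
  rewrite /unif (negbTE lA); case: eqP => // E; case/negP: H; rewrite E.
  exact: imset_f.
rewrite -big_mkcondr sumr_const /= /unif lU.
rewrite -(card_fibre_leg lB) natrM mulfK //; congr _%:R.
by apply: eq_card => t'; rewrite in_set.
Qed.

End Fibre.

Hypotheses (n_gt0 : (0 < n)%N) (sum_in : (\sum_k i k = n - 1)%N).

Lemma sum_coupled_step_leg t s p x :
  coupled (forest t p) s p ->
  \sum_y coupled_step_prob t s p (x, y) = unif R (untreated s) x.
Proof.
move=> cpl; rewrite /= -mulr_sumr -[RHS]mulr1; congr (_ * _).
rewrite (bigD1 None) //= (reindex_omap Some id) => [|[l|]] //=.
case: ifPn => [_ | ].
  by rewrite big1 ?addr0 // => -[].
rewrite negb_or add0r => /andP[ub U0].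
rewrite -[RHS](@sum_unif _ _ (admissible_legs t s p (leg_vertex x))).
  by apply: eq_bigl => l; rewrite eqxx.
exact: admissible_legs_neq0.
Qed.

Lemma sum_coupled_step_fibre t s p xy :
  coupled (forest t p) s p ->
  \sum_(t' in agreeing (occupied p) (val t)) coupled_step_prob t' s p xy =
  #|agreeing (occupied p) (val t)|%:R * fcm_step_prob R s xy.
Proof.
case: xy => x y cpl; rewrite /= -mulr_sumr mulrCA; congr (_ * _).
case: ifPn => [_ | ]; first by rewrite sumr_const -[_ *+ _]mulr_natl.
rewrite negb_or => /andP[ub U0]; case: y => [l|]; first exact: sum_unif_admissible.
by rewrite big1 // mulr0.
Qed.

(** The form in which the induction of [sum_coupled_prob_fibre] sums over the
    values of the parent edges that a step reveals: [w] is the law of the step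
    and [g] the law of what follows. *)
Lemma sum_agreeing_refine occ occ' t (w g : plane_tree i -> R) c :
    occ \subset occ' ->
    (forall t1 t2, t1 \in agreeing occ (val t) -> t2 \in agreeing occ' (val t1) ->
       w t2 = w t1) ->
    (forall t1, t1 \in agreeing occ (val t) -> w t1 != 0 ->
       \sum_(t2 in agreeing occ' (val t1)) g t2 =
       #|agreeing occ' (val t1)|%:R * c) ->
  \sum_(t1 in agreeing occ (val t)) w t1 * g t1 =
  (\sum_(t1 in agreeing occ (val t)) w t1) * c.
Proof.
move=> oo wE gE; rewrite mulr_suml.
pose h (t1 : plane_tree i) := agreeing occ' (val t1).
rewrite (partition_big h xpredT) //= [RHS](partition_big h xpredT) //=.
apply: eq_bigr => C _.
have [t1 /andP[t1K /eqP t1C] | none] :=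
  pickP (fun t1 => (t1 \in agreeing occ (val t)) && (h t1 == C)); last first.
  by rewrite !big_pred0.
have CE t2 : (t2 \in agreeing occ (val t)) && (h t2 == C) = (t2 \in h t1).
  apply/andP/idP => [[_ /eqP] | t2C].
    by rewrite t1C => <-; apply: agreeing_refl.
  by rewrite -(eq_agreeing t1K) (agreeingW oo t2C) -t1C /h (eq_agreeing t2C).
rewrite !(eq_bigl _ _ CE).
rewrite (eq_bigr (fun t2 => w t1 * g t2)) => [|t2 t2C]; last by rewrite (wE t1).
rewrite [RHS](eq_bigr (fun=> w t1 * c)) => [|t2 t2C]; last by rewrite (wE t1).
rewrite -mulr_sumr sumr_const -[_ *+ _]mulr_natl.
have [-> | w0] := eqVneq (w t1) 0; first by rewrite !mul0r mulr0.
by rewrite gE // mulrCA.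
Qed.

(** The tree stays uniform among the possible ones as steps are made: a step
    gives the same weight to all trees that are still possible after it, since
    its law depends on the parent of the newly occupied vertex only.  With
    [sum_coupled_step_fibre], the out-legs and their partners have then the
    law of the frozen configuration model. *)
Theorem sum_coupled_prob_fibre t s p tr :
  coupled (forest t p) s p ->
  \sum_(t' in agreeing (occupied p) (val t)) coupled_prob_from t' s p tr =
  #|agreeing (occupied p) (val t)|%:R * fcm_prob_from R s tr.
Proof.
elim: tr t s p => [|[x y] tr IHtr] t s p cpl; first by rewrite /= sumr_const mulr1.
set p' := park_car (val t) p x.
have p'E t' : t' \in agreeing (occupied p) (val t) -> park_car (val t') p x = p'.
  by move=> t'K; rewrite /p' !park_carE (eq_occupied t'K).
rewrite /= (eq_bigr (fun t' => coupled_step_prob t' s p (x, y) *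
  coupled_prob_from t' (fcm_step s (x, y)) p' tr)) => [|t' t'K]; last by rewrite p'E.
rewrite mulrA -(sum_coupled_step_fibre (x, y) cpl).
apply: (@sum_agreeing_refine _ (occupied p')).
- exact: occupied_park_car.
- move=> t1 t2 t1K t2K; rewrite /=; case: ifPn => //.
  rewrite negb_or => /andP[ub _]; case: y => // l.
  congr (_ * unif R _ l); rewrite /admissible_legs.
  have t21 : t2 \in agreeing (occupied p) (val t1).
    exact: agreeingW (occupied_park_car _ _ _) t2K.
  rewrite (eq_occupied t21); set r := top _ _.
  suff -> : val t2 r = val t1 r by [].
  move: t2K; rewrite inE => /forall_inP H; apply/eqP/H.
  rewrite /r (eq_occupied t1K) /p' park_carE -(coupled_blue cpl) (negbTE ub) /=.
  by rewrite setU11.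
move=> t1 t1K w0; apply: IHtr.
rewrite -(p'E _ t1K); apply: coupled_stepW w0.
by rewrite (eq_occupied t1K).
Qed.

Lemma sum_coupled_prob t s p m :
    coupled (forest t p) s p -> #|untreated s| = m ->
  \sum_(tr : m.-tuple step) coupled_prob_from t s p tr = 1.
Proof.
elim: m s p => [|m IHm] s p cpl sm.
  exact: (big_tuple_nil xpredT (coupled_prob_from t s p)).
rewrite (big_tuple_cons _ xpredT (coupled_prob_from t s p)) /=.
transitivity (\sum_xy coupled_step_prob t s p xy).
  apply: eq_bigr => -[x y] _; rewrite -mulr_sumr.
  have [-> | w0] := eqVneq (coupled_step_prob t s p (x, y)) 0.
    by rewrite mul0r.
  rewrite IHm ?mulr1 //; first exact: coupled_stepW.
  have xU : x \in untreated s.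
    by move: w0; rewrite mulf_eq0 negb_or /unif; case: (x \in _); rewrite ?eqxx.
  have -> : untreated (fcm_step s (x, y)) = untreated s :\ x.
    by apply/setP=> z; rewrite /untreated treated_step !inE negb_or.
  by have := cardsD1 x (untreated s); rewrite xU sm => -[].
rewrite (eq_bigr (fun xy => coupled_step_prob t s p (xy.1, xy.2))) => [|[]] //.
rewrite -(pair_bigA _ (fun x y => coupled_step_prob t s p (x, y))) /=.
rewrite (eq_bigr _ (fun x _ => sum_coupled_step_leg x cpl)) sum_unif //.
by rewrite -card_gt0 sm.
Qed.

Fixpoint leg_order_prob (S : {set leg a}) (xs : seq (leg a)) : R :=
  if xs is x :: xs' then unif R (~: S) x * leg_order_prob (x |: S) xs' else 1.

(** The right-hand side does not involve [t]: the order in which the out-legs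
    are treated is independent of the tree. *)
Lemma sum_coupled_prob_order t s p (xs : seq (leg a)) m :
    coupled (forest t p) s p ->
  \sum_(tr : m.-tuple step | out_legs tr == xs) coupled_prob_from t s p tr =
  if size xs == m then leg_order_prob (treated s) xs else 0.
Proof.
elim: xs m s p => [|x xs IHxs] [|m] s p cpl.
- exact: (big_tuple_nil (fun tr => out_legs tr == [::]) (coupled_prob_from t s p)).
- by rewrite big_pred0 // => tr; case/tupleP: tr.
- exact: (big_tuple_nil (fun tr => out_legs tr == _) (coupled_prob_from t s p)).
rewrite (big_tuple_cons _ (fun tr => out_legs tr == _) (coupled_prob_from t s p)) /=.
pose c := if size xs == m then leg_order_prob (x |: treated s) xs else 0.
rewrite (eq_bigr (fun xy : step =>
  if xy.1 == x then coupled_step_prob t s p (x, xy.2) * c else 0)); last first.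
  move=> [x' y] _; rewrite -mulr_sumr [(x', y).1]/= [(x', y).2]/=.
  case: (x' =P x) => [-> | /eqP/negbTE x'x]; last first.
    by rewrite big_pred0 ?mulr0 // => tr; rewrite eqseq_cons x'x.
  have [-> | w0] := eqVneq (coupled_step_prob t s p (x, y)) 0.
    by rewrite !mul0r.
  have -> : c = if size xs == m
      then leg_order_prob (treated (fcm_step s (x, y))) xs else 0.
    by rewrite treated_step.
  rewrite -(IHxs m _ (park_car (val t) p x)); last exact: coupled_stepW.
  by congr (_ * _); apply: eq_bigl => tr; rewrite eqseq_cons eqxx.
rewrite -(pair_bigA _ (fun x' y =>
  if x' == x then coupled_step_prob t s p (x, y) * c else 0)).
rewrite (bigD1 x) //= [X in _ + X]big1 => [|x' /negbTE x'x]; last first.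
  by rewrite big1 // x'x.
rewrite eqxx addr0 -mulr_suml sum_coupled_step_leg // eqSS /c.
by case: ifP => _; rewrite ?mulr0.
Qed.

End CoupledLaw.

(** * Components at the end of the coupled construction *)

Section CoupledComponents.
Variables (n : nat) (i a : 'I_n -> nat).
Variables (t : plane_tree i) (s : fcm_state i a) (p : parking_state a).
Let F := occupied_forest (val t) (occupied p).
Hypothesis cpl : coupled F s p.

Lemma occupied_top r v : is_root (val t) r -> top F v \in occupied p -> top F v = r.
Proof.
move=> tr vo; apply: tree_root_unique tr.
have := is_root_top v (acyclic_occupied t (occupied p)).
by rewrite is_root_occupied vo.
Qed.

Lemma np_component_blue r : is_root (val t) r -> r \in occupied p ->
  np_component (val t) (occupied p) r = blue s.
Proof.
move=> tr ro; rewrite np_componentE -/F; apply/setP=> v.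
rewrite inE (coupled_blue cpl) [top F r]top_root; last first.
  by rewrite is_root_occupied tr orbT.
by apply/eqP/idP => [-> // | /(occupied_top tr)].
Qed.

Lemma np_components_white :
  [set C in np_components (val t) (occupied p)
     | Some C != root_component (val t) (occupied p)] = white_components s.
Proof.
have [r tr] := tree_rootE t; rewrite (root_componentE _ tr).
have rF : top F r = r by rewrite top_root // is_root_occupied tr orbT.
have npE v : v \notin blue s ->
    np_component (val t) (occupied p) v = weak_component (fcm_edge (matching s)) v.
  by move=> vb; rewrite np_componentE (coupled_white cpl).
apply/setP=> C; rewrite !in_set.
apply/andP/andP => [[/imsetP[v _ CE] Cr] | [/imsetP[v _ CE] /subsetP Cw]].
  have vb : v \notin blue s.
    apply: contraNN Cr; rewrite (coupled_blue cpl) => vo; have vr := occupied_top tr vo.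
    by rewrite -{1}vr vo CE -/(np_component _ _ _) !np_componentE -/F rF vr.
  rewrite CE -/(np_component _ _ _) npE //; split; first exact: imset_f.
  apply/subsetP=> w; rewrite (coupled_white cpl) // !inE (coupled_blue cpl) => /eqP->.
  by rewrite -(coupled_blue cpl).
have vb : v \notin blue s by have := Cw v; rewrite CE mem_weak_component inE => ->.
rewrite CE -npE //; split; first exact: imset_f.
case: ifP => // ro; apply: contraNneq vb => -[/setP/(_ r)].
by rewrite !np_componentE -/F !inE eqxx rF => /eqP E; rewrite (coupled_blue cpl) -E.
Qed.

End CoupledComponents.

(** * Conditioning on the final forest *)

Section FinalForest.
Variables (n : nat) (i a : 'I_n -> nat).
Implicit Types (t : plane_tree i) (xs : seq (leg a)).

Definition final_forest (f : plane_forest i) xs := np_forest f (occupied (park f xs)).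

Lemma final_forest_contained t xs : contains_forest (final_forest (val t) xs) (val t).
Proof. by rewrite contains_forestE agreeing_refl. Qed.

Lemma final_forest_stable t t' xs :
  contains_forest (final_forest (val t) xs) (val t') ->
  final_forest (val t') xs = final_forest (val t) xs.
Proof.
rewrite contains_forestE => tt'.
by rewrite /final_forest (park_agreeing tt') (eq_np_forest tt').
Qed.

(** For each order of the cars, two trees that contain [phi] lead to [phi] both
    or not at all, because parking has seen only the edges of [phi]. *)
Lemma final_forest_eq t t' xs phi :
  contains_forest phi (val t) -> contains_forest phi (val t') ->
  (final_forest (val t) xs == phi) = (final_forest (val t') xs == phi).
Proof.
move=> pt pt'; apply/eqP/eqP => E.
  by rewrite (@final_forest_stable t) E.
by rewrite (@final_forest_stable t') E.
Qed.

End FinalForest.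

(** * The coupling *)

Section CoupledProb.
Variables (R : realFieldType) (n : nat) (i a : 'I_n -> nat).
Hypotheses (n_gt0 : (0 < n)%N) (sum_in : (\sum_k i k = n - 1)%N).
Implicit Types (t : plane_tree i).

Local Notation step := (leg a * option (leg i))%type.
Local Notation M := (\sum_(k < n) a k)%N.

Definition coupled_prob t (tr : seq step) : R :=
  coupled_prob_from R t (fcm_init i a) (ParkingState set0 set0) tr.

Lemma coupled_prob_ge0 t tr : 0 <= coupled_prob t tr.
Proof. exact: coupled_prob_from_ge0. Qed.

Lemma coupled_probW t tr : coupled_prob t tr != 0 ->
  let p := park (val t) [seq xy.1 | xy <- tr] in
  coupled (occupied_forest (val t) (occupied p)) (fcm_run tr) p.
Proof. by apply: coupled_run; apply: coupled_init. Qed.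

Lemma coupled_prob_tree t : \sum_(tr : M.-tuple step) coupled_prob t tr = 1.
Proof.
apply: sum_coupled_prob => //; first exact: coupled_init.
by rewrite /untreated /= setC0 cardsT card_leg.
Qed.

Lemma coupled_prob_fcm tr :
  \sum_t coupled_prob t tr = #|plane_tree i|%:R * fcm_prob R tr.
Proof.
have: (0 < #|plane_tree i|)%N by rewrite card_plane_tree // fact_gt0.
case/card_gt0P=> t _.
have := @sum_coupled_prob_fibre R _ _ _ n_gt0 sum_in _ _ (ParkingState set0 set0)
  tr (coupled_init a t n_gt0 sum_in).
have -> : agreeing set0 (val t) = setT.
  by apply/setP=> t'; rewrite !inE; apply/forall_inP=> v; rewrite inE.
rewrite cardsT => <-; by apply: eq_bigl => t'; rewrite inE.
Qed.

Definition forest_weight phi t : R :=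
  \sum_(tr : M.-tuple step | final_forest (val t) [seq xy.1 | xy <- tr] == phi)
     coupled_prob t tr.

Lemma forest_weight0 phi t : ~~ contains_forest phi (val t) -> forest_weight phi t = 0.
Proof.
move=> pt; apply: big_pred0 => tr; apply: contraNF pt => /eqP <-.
exact: final_forest_contained.
Qed.

(** By [sum_coupled_prob_order] the weight is a sum over the orders of the cars
    that lead to [phi], which are the same for both trees. *)
Lemma forest_weight_eq phi t t' :
  contains_forest phi (val t) -> contains_forest phi (val t') ->
  forest_weight phi t = forest_weight phi t'.
Proof.
move=> pt pt'.
have wE t1 : forest_weight phi t1 =
    \sum_(xs : M.-tuple (leg a) | final_forest (val t1) xs == phi)
      leg_order_prob R set0 xs.
  rewrite /forest_weight.
  pose legs (tr : M.-tuple step) := [tuple of [seq xy.1 | xy <- tr]].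
  pose leads (xs : M.-tuple (leg a)) := final_forest (val t1) xs == phi.
  rewrite (partition_big legs leads) //=.
  apply: eq_bigr => xs xsphi.
  have := @sum_coupled_prob_order R _ _ _ n_gt0 sum_in _ _
    (ParkingState set0 set0) xs M (coupled_init a t1 n_gt0 sum_in).
  rewrite size_tuple eqxx => <-; apply: eq_bigl => tr; rewrite -val_eqE /=.
  case: ([seq xy.1 | xy <- tr] =P tval xs) => [->|_]; last by rewrite andbF.
  by move: xsphi; rewrite /leads => ->.
rewrite !wE; apply: eq_bigl => xs; exact: final_forest_eq.
Qed.

End CoupledProb.

Theorem proposition3 (R : realFieldType) (n : nat) (i a : 'I_n -> nat)
    (n_ge1 : (1 <= n)%N) (sum_in : (\sum_(k < n) i k = n - 1)%N) :
  exists (Omega : finType) (P : Omega -> R)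
         (T : Omega -> plane_tree i)
         (XY : Omega -> (\sum_(k < n) a k)%N.-tuple (leg a * option (leg i))),
    let tree w : plane_forest i := val (T w) in
    let fcm w := fcm_run (XY w) in
    let parking w := park (tree w) [seq xy.1 | xy <- XY w] in
    let occ w := occupied (parking w) in
    let forest w := np_forest (tree w) (occ w) in
    [/\ is_pmf P,
        forall t : plane_tree i, Pr P [pred w | T w == t] = unif R setT t,
        forall tr : (\sum_(k < n) a k)%N.-tuple (leg a * option (leg i)),
          Pr P [pred w | XY w == tr] = fcm_prob R tr &
        [/\ (* (1) *)
            forall w,
              (forall r, is_root (tree w) r -> r \in occ w ->
                 np_component (tree w) (occ w) r = blue (fcm w)) /\
              [set C in np_components (tree w) (occ w)
                 | Some C != root_component (tree w) (occ w)]
                = white_components (fcm w),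
            (* (2) *)
            forall w, deleted (fcm w) = exited (parking w) &
            (* (3) *)
            forall phi, 0 < Pr P [pred w | forest w == phi] ->
            forall t : plane_tree i,
              cPr P [pred w | T w == t] [pred w | forest w == phi]
                = unif R [set t' : plane_tree i | contains_forest phi (val t')] t]].
Proof.
pose M := (\sum_(k < n) a k)%N; pose step := (leg a * option (leg i))%type.
pose W : finType := (plane_tree i * M.-tuple step)%type.
pose q (w : W) : R := coupled_prob R w.1 w.2.
(* The statements on the components and on the deleted out-legs hold for every
   outcome, so that impossible outcomes have to be left out. *)
pose S : {pred W} := [pred w | q w != 0].
pose N : R := #|plane_tree i|%:R.
have N0 : N != 0 by rewrite pnatr_eq0 -lt0n card_plane_tree // fact_gt0.
pose Omega : finType := {w : W | w \in S}.
pose P (w : Omega) : R := N^-1 * q (val w).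
have PrE (E : pred W) :
    Pr P [pred w : Omega | E (val w)] = N^-1 * \sum_(w | E w) q w.
  rewrite /Pr /= -(big_sub_cond S E (fun w => N^-1 * q w)) /= -mulr_sumr.
  congr (_ * _); rewrite big_mkcond [RHS]big_mkcond.
  apply: eq_bigr => w _; rewrite [w \in S]unfold_in /=.
  by case: eqVneq => [->|_] //=; rewrite if_same.
have PrT (E : plane_tree i -> pred (seq step)) (Q : pred (plane_tree i)) :
    Pr P [pred w : Omega | Q (val w).1 && E (val w).1 (val w).2] =
    N^-1 * \sum_(t | Q t) \sum_(tr : M.-tuple step | E t tr) coupled_prob R t tr.
  by rewrite (PrE (fun w => Q w.1 && E w.1 w.2)) pair_big_dep.
exists Omega, P, (fun w => (val w).1), (fun w => (val w).2).
split; [split | | |split].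
- by move=> w; rewrite mulr_ge0 ?invr_ge0 ?ler0n ?coupled_prob_ge0.
- have := PrT (fun _ => xpredT) xpredT; rewrite /Pr /= => ->.
  rewrite (eq_bigr (fun=> 1)) => [|t _]; last exact: coupled_prob_tree.
  by rewrite sumr_const mulVf.
- move=> t; transitivity (Pr P [pred w : Omega | ((val w).1 == t) && true]).
    by apply: eq_bigl => w; rewrite /= andbT.
  rewrite (PrT (fun _ => xpredT) (pred1 t)) big_pred1_eq coupled_prob_tree // mulr1.
  by rewrite /unif inE cardsT.
- move=> tr; rewrite (PrE (fun w => w.2 == tr)).
  rewrite -[fcm_prob R tr](mulKf N0) -(coupled_prob_fcm R n_ge1 sum_in tr).
  congr (_ * _); rewrite (reindex (fun t => (t, tr))) /=.
    by apply: eq_bigl => t; rewrite eqxx.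
  by exists fst => [t _ | [t tr'] /eqP <-].
- move=> w; have cpl := coupled_probW n_ge1 sum_in (valP w : q (val w) != 0).
  split=> [r|]; last exact: (np_components_white cpl).
  exact: (np_component_blue cpl).
- move=> w; apply: coupled_exited.
  exact: (coupled_probW n_ge1 sum_in (valP w : q (val w) != 0)).
move=> phi; pose C := [set t' : plane_tree i | contains_forest phi (val t')].
pose weight := forest_weight R a phi.
pose E (t : plane_tree i) (tr : seq step) :=
  final_forest (val t) [seq xy.1 | xy <- tr] == phi.
have PphiE : Pr P [pred w : Omega | E (val w).1 (val w).2] =
    N^-1 * \sum_(t in C) weight t.
  have := PrT E xpredT; rewrite /= => ->; congr (_ * _).
  rewrite [RHS]big_mkcond; apply: eq_bigr => t _; rewrite inE.
  by case: ifPn => // /(forest_weight0 R a).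
rewrite /cPr PphiE => Pphi t; rewrite (PrT E (pred1 t)) big_pred1_eq.
rewrite -[\sum_(tr | _) _]/(weight t) /unif -/C.
case: ifP => [|/negbT]; rewrite inE => pt; last first.
  by rewrite /weight forest_weight0 // mulr0 mul0r.
move: Pphi; have -> : \sum_(t0 in C) weight t0 = #|C|%:R * weight t.
  rewrite mulr_natl -sumr_const; apply: eq_bigr => t'; rewrite inE => pt'.
  exact: forest_weight_eq.
move/lt0r_neq0; rewrite !mulf_eq0 !negb_or => /and3P[N0' C0 x0].
by rewrite invfM mulrACA divff // mul1r invfM mulrCA divff // mulr1.
Qed.
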